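(* For all $n\ge 4$, $H_2(G_n^{sph})\cong\mathbb{Z}$ and $H_3(G_n^{sph})\cong H_3^{[2]}(G_n^{sph})$.
   Context: Graphs are simple and undirected. The $n$-th Greene sphere $G_n^{sph}$ is the graph obtained from a $2n$-cycle with vertices $0,1,\dots,2n-1$ (in cyclic order) by adjoining two further vertices $u$ and $v$, where $u$ is adjacent to all odd vertices and $v$ is adjacent to all even vertices. A graph map $f\colon G\to G'$ is a map of vertex sets sending every edge to an edge or to a single vertex. $I^n$ denotes the discrete $n$-cube graph, with vertex set $\{0,1\}^n$, two vertices being adjacent iff they differ in exactly one coordinate ($I^0$ is a single vertex). A singular $n$-cube in $G$ is a graph map $\sigma\colon I^n\to G$; it is injective if it is injective on vertices. For $1\le i\le n$, $f_i^-\sigma$ and $f_i^+\sigma$ are the singular $(n-1)$-cubes obtained by fixing the $i$-th coordinate equal to $0$ and $1$ respectively. $\sigma$ is degenerate if $f_i^-\sigma=f_i^+\sigma$ for some $i$. Let $Q_n(G)$ be the free abelian group on singular $n$-cubes, with $\partial_n\sigma=\sum_{i=1}^n(-1)^i(f_i^-\sigma-f_i^+\sigma)$, let $D_*(G)\subseteq Q_*(G)$ be the subcomplex generated by degenerate cubes, $C_*(G)=Q_*(G)/D_*(G)$, and $H_n(G)=H_n(C_*(G))$ (discrete cubical homology). The degree of a singular $n$-cube $\sigma$ is the largest dimension $k$ of an injective face of $\sigma$ (faces of all dimensions $0\le k\le n$, including $\sigma$ itself, obtained by fixing $n-k$ of the coordinates). $C_n^k(G)\le C_n(G)$ is the subgroup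 generated by the nondegenerate singular $n$-cubes of degree at most $k$; for each $k$ this gives a subcomplex $C_*^k(G)$. Put $C_*^{[k]}(G)=C_*^k(G)/C_*^{k-1}(G)$ and $H_n^{[k]}(G)=H_n(C_*^{[k]}(G))$. *)

(* Defs.v *)
From HB Require Import structures.
From mathcomp Require Import all_boot all_order all_algebra.
From mathcomp Require Import boolp zify.

Set Implicit Arguments.
Unset Strict Implicit.
Unset Printing Implicit Defensive.

Import GRing.Theory.
Local Open Scope ring_scope.

Definition isomorphic (U V : zmodType) : Prop :=
  exists f : {additive U -> V}, bijective f.

Definition subgroup (V : zmodType) (P : zmodClosed V) := {x : V | x \in P}.

HB.instance Definition _ V P := Choice.on (@subgroup V P).
HB.instance Definition _ V P := SubType.on (@subgroup V P).
HB.instance Definition _ V P :=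
  [SubChoice_isSubZmodule of @subgroup V P by <:].

Definition preim_group (U V : zmodType) (f : {additive U -> V})
  (P : zmodClosed V) : {pred U} := fun x => f x \in P.

Section PreimGroup.
Variables (U V : zmodType) (f : {additive U -> V}) (P : zmodClosed V).

Fact preim_group_closed : zmod_closed (preim_group f P).
Proof.
split=> [|x y Px Py]; first by change (f 0 \in P); rewrite raddf0 rpred0.
by change (f (x - y) \in P); rewrite raddfB rpredB.
Qed.

HB.instance Definition _ :=
  GRing.isZmodClosed.Build U (preim_group f P) preim_group_closed.
End PreimGroup.

(* [P / (P :&: Q)]; in all uses below [Q] is contained in [P]. *)
Definition subquotient (V : zmodType) (P Q : zmodClosed V) : zmodType :=
  Quotient.quot (preim_group (\val : subgroup P -> V) Q).

Definition generated (V : zmodType) (S : V -> Prop) : {pred V} :=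
  fun x => `[< forall P : zmodClosed V, (forall s, S s -> s \in P) -> x \in P >].

Section Generated.
Variables (V : zmodType) (S : V -> Prop).

Fact generated_closed : zmod_closed (generated S).
Proof.
split; first by apply/asboolP => P _; rewrite rpred0.
by move=> x y /asboolP Sx /asboolP Sy; apply/asboolP => P SP;
   rewrite rpredB ?Sx ?Sy.
Qed.

HB.instance Definition _ :=
  GRing.isZmodClosed.Build V (generated S) generated_closed.

Lemma mem_generated x : S x -> x \in generated S.
Proof. by move=> Sx; apply/asboolP => P; apply. Qed.

Lemma generated_sub (P : zmodClosed V) x :
  (forall s, S s -> s \in P) -> x \in generated S -> x \in P.
Proof. by move=> SP /asboolP; apply. Qed.
End Generated.

Lemma generated_map (U V : zmodType) (f : {additive U -> V}) (S : U -> Prop)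
    (P : zmodClosed V) x :
  (forall s, S s -> f s \in P) -> x \in generated S -> f x \in P.
Proof.
move=> SP Sx; have : x \in preim_group f P by apply: generated_sub Sx.
by [].
Qed.

(* Graded by [nat]; the differential out of degree 0 is the zero map, left
   implicit. *)
Record chain_complex := ChainComplex {
  chain :> nat -> zmodType;
  bd : forall n, {additive chain n.+1 -> chain n};
  bdK : forall n x, bd n (bd n.+1 x) = 0 }.

Section Homology.
Variables (K : chain_complex) (n : nat).

Definition cycles : {pred K n} :=
  match n return {pred K n} with
  | 0 => fun=> true
  | m.+1 => fun x => bd K m x == 0
  end.

Definition boundaries : {pred K n} := fun x => `[< exists y, x = bd K n y >].

End Homology.

Fact cycles_closed K n : zmod_closed (@cycles K n).
Proof.
case: n => [|n]; first by split.
split; first by rewrite unfold_in /= raddf0.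
move=> x y; rewrite !unfold_in /= => /eqP x0 /eqP y0.
by rewrite raddfB x0 y0 subr0.
Qed.

Fact boundaries_closed K n : zmod_closed (@boundaries K n).
Proof.
split; first by apply/asboolP; exists 0; rewrite raddf0.
move=> _ _ /asboolP[x ->] /asboolP[y ->]; apply/asboolP.
by exists (x - y); rewrite raddfB.
Qed.

HB.instance Definition _ K n :=
  GRing.isZmodClosed.Build (chain K n) (@cycles K n) (@cycles_closed K n).
HB.instance Definition _ K n :=
  GRing.isZmodClosed.Build (chain K n) (@boundaries K n)
    (@boundaries_closed K n).

Definition homology (n : nat) (K : chain_complex) : zmodType :=
  subquotient (@cycles K n) (@boundaries K n).

Record subcomplex (K : chain_complex) := Subcomplex {
  part :> forall n, zmodClosed (K n);
  part_bd : forall n x, x \in part n.+1 -> bd K n x \in part n }.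

Section SubQuotientComplex.
Variables (K : chain_complex) (A : subcomplex K).

Definition sub_bd n (x : subgroup (A n.+1)) : subgroup (A n) :=
  Sub (bd K n (\val x)) (part_bd (valP x)).

Fact sub_bd_zmod_morphism n : zmod_morphism (@sub_bd n).
Proof. by move=> x y; apply: val_inj; rewrite /= !raddfB. Qed.

HB.instance Definition _ n :=
  GRing.isZmodMorphism.Build (subgroup (A n.+1)) (subgroup (A n)) (@sub_bd n)
    (@sub_bd_zmod_morphism n).

Fact sub_bdK n x : @sub_bd n (@sub_bd n.+1 x) = 0.
Proof. by apply: val_inj; rewrite /= bdK. Qed.

Definition sub_complex : chain_complex := ChainComplex sub_bdK.

Local Open Scope quotient_scope.

Definition quot_bd n (x : Quotient.quot (A n.+1)) : Quotient.quot (A n) :=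
  \pi_(Quotient.quot (A n)) (bd K n (repr x)).

Lemma quot_bd_pi n (x : K n.+1) :
  quot_bd (\pi_(Quotient.quot (A n.+1)) x) =
  \pi_(Quotient.quot (A n)) (bd K n x).
Proof.
rewrite /quot_bd; apply/eqP; rewrite -Quotient.idealrBE -raddfB.
by apply: part_bd; rewrite Quotient.idealrBE reprK.
Qed.

Fact quot_bd_zmod_morphism n : zmod_morphism (@quot_bd n).
Proof.
move=> x y; rewrite -[x]reprK -[y]reprK -raddfB /= !quot_bd_pi.
by rewrite raddfB /= raddfB.
Qed.

HB.instance Definition _ n :=
  GRing.isZmodMorphism.Build (Quotient.quot (A n.+1)) (Quotient.quot (A n))
    (@quot_bd n) (@quot_bd_zmod_morphism n).

Fact quot_bdK n x : @quot_bd n (@quot_bd n.+1 x) = 0.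
Proof. by rewrite -[x]reprK !quot_bd_pi bdK raddf0. Qed.

Definition quot_complex : chain_complex := ChainComplex quot_bdK.

End SubQuotientComplex.

(* The subcomplex [A :&: B] of [A]. *)
Section Restrict.
Variables (K : chain_complex) (A B : subcomplex K).

Definition restrict_part n : zmodClosed (sub_complex A n) :=
  preim_group (\val : subgroup (A n) -> K n) (B n).

Fact restrict_part_bd n x :
  x \in restrict_part n.+1 -> bd (sub_complex A) n x \in restrict_part n.
Proof. exact: part_bd. Qed.

Definition restrict : subcomplex (sub_complex A) := Subcomplex restrict_part_bd.
End Restrict.

Record graph := Graph {
  vertex :> finType;
  adj : rel vertex;
  adj_sym : symmetric adj;
  adj_irr : irreflexive adj }.

Definition is_graph_map (G G' : graph) (f : G -> G') : bool :=
  [forall x, forall y, adj x y ==> (adj (f x) (f y) || (f x == f y))].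

Record graph_map (G G' : graph) := GraphMap {
  graph_fun :> {ffun G -> G'};
  graph_funP : is_graph_map graph_fun }.

HB.instance Definition _ G G' := [isSub for @graph_fun G G'].
HB.instance Definition _ G G' := [Finite of graph_map G G' by <:].

Section CubeGraph.
Variable n : nat.

Definition cube_adj : rel {ffun 'I_n -> bool} :=
  fun x y => #|[set i | x i != y i]| == 1%N.

Fact cube_adj_sym : symmetric cube_adj.
Proof.
by move=> x y; rewrite /cube_adj; under eq_finset do rewrite eq_sym.
Qed.

Fact cube_adj_irr : irreflexive cube_adj.
Proof.
by move=> x; rewrite /cube_adj; under eq_finset do rewrite eqxx; rewrite cards0.
Qed.

Definition cube_graph : graph := Graph cube_adj_sym cube_adj_irr.
End CubeGraph.

Definition singular_cube (G : graph) (n : nat) := graph_map (cube_graph n) G.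

HB.instance Definition _ G n := Finite.on (singular_cube G n).

Section Greene.
Variable n : nat.

(* [inl i] is the i-th vertex of the cycle, [inr true] is u (adjacent to the odd
   vertices) and [inr false] is v (adjacent to the even ones). *)
Definition greene_adj : rel ('I_(2 * n)%N + bool)%type := fun x y =>
  match x, y with
  | inl i, inl j =>
      (j == i.+1 %% (2 * n) :> nat) || (i == j.+1 %% (2 * n) :> nat)
  | inl i, inr b => odd i == b
  | inr b, inl j => odd j == b
  | inr _, inr _ => false
  end%N.

Fact greene_adj_sym : symmetric greene_adj.
Proof. by case=> [i|b] [j|c] //=; rewrite orbC. Qed.

Fact greene_adj_irr : irreflexive greene_adj.
Proof.
case=> [[i lt_i]|b] //=; rewrite orbb; apply/negbTE/eqP => def_i.
have /(congr1 odd) := def_i.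
by rewrite odd_mod ?mul2n ?odd_double //= => /esym/negP; case: (odd i).
Qed.

Definition greene_sphere : graph := Graph greene_adj_sym greene_adj_irr.
End Greene.

Section Faces.
Variable G : graph.

Definition insert n (i : 'I_n.+1) (b : bool) (x : {ffun 'I_n -> bool}) :
    {ffun 'I_n.+1 -> bool} :=
  [ffun j => if unlift i j is Some k then x k else b].

Fact face_subproof n (i : 'I_n.+1) b (s : singular_cube G n.+1) :
  is_graph_map (G := cube_graph n) [ffun x => s (insert i b x)].
Proof.
apply/forallP => x; apply/forallP => y; apply/implyP => xy; rewrite !ffunE.
have /forallP/(_ (insert i b x))/forallP/(_ (insert i b y))/implyP := graph_funP s.
apply; move: xy; rewrite /= /cube_adj => /eqP <-.
rewrite -(card_imset _ (@lift_inj _ i)); apply/eqP/eq_card => k.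
rewrite !inE !ffunE; case: unliftP => [l|] ->.
  by rewrite (mem_imset _ _ (@lift_inj _ i)) inE.
by rewrite eqxx; apply/esym/imsetP => -[l _ /eqP]; rewrite (negPf (neq_lift _ _)).
Qed.

(* [face i false] and [face i true] are the faces f_(i+1)^- and f_(i+1)^+. *)
Definition face n (i : 'I_n.+1) b (s : singular_cube G n.+1) :
  singular_cube G n := GraphMap (face_subproof i b s).

(* [swap i j] is the position of [i] once [lift i j] has been removed. *)
Definition swap n (i : 'I_n.+2) (j : 'I_n.+1) : 'I_n.+1 :=
  odflt ord0 (unlift (lift i j) i).

Lemma lift_swap n (i : 'I_n.+2) j : lift (lift i j) (swap i j) = i.
Proof.
rewrite /swap; case: unliftP => [k {2}->|] //= /eqP.
by rewrite (negPf (neq_lift _ _)).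
Qed.

Lemma swapK n (i : 'I_n.+2) j : swap (lift i j) (swap i j) = j.
Proof. by apply: (@lift_inj _ i); rewrite -{1}(lift_swap i j) lift_swap. Qed.

Lemma swap_sign n (i : 'I_n.+2) (j : 'I_n.+1) :
  odd (lift i j + swap i j) = ~~ odd (i + j).
Proof.
have := congr1 val (lift_swap i j); rewrite /= /bump.
by case: (leqP i j); case: (leqP _ (swap i j)) => /=; lia.
Qed.

Lemma lift_lift n (i : 'I_n.+2) (j : 'I_n.+1) (l : 'I_n) :
  lift i (lift j l) = lift (lift i j) (lift (swap i j) l).
Proof.
apply: val_inj; rewrite /= bumpC; congr (bump _ (bump _ _)).
have := congr1 val (lift_swap i j); rewrite /= /bump /unbump.
by case: (leqP i j); case: (leqP _ (swap i j)) => /=; lia.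
Qed.

Lemma faceC n (i : 'I_n.+2) (j : 'I_n.+1) a b (s : singular_cube G n.+2) :
  face j b (face i a s) = face (swap i j) a (face (lift i j) b s).
Proof.
apply/val_inj/ffunP => x; rewrite /= !ffunE; congr (s _).
apply/ffunP => k; rewrite !ffunE.
case: (unliftP i k) => [m|] ->.
  rewrite ffunE; case: (unliftP j m) => [l|] ->.
    by rewrite lift_lift liftK ffunE liftK.
  by rewrite unlift_none.
by rewrite -{2}(lift_swap i j) liftK ffunE unlift_none.
Qed.

Definition degenerate n : pred (singular_cube G n) :=
  match n with
  | 0 => fun=> false
  | m.+1 => fun s => [exists i : 'I_m.+1, face i false s == face i true s]
  end.

(* The points of the n-cube on the face obtained by fixing the i-th coordinate
   to b whenever a i = Some b; the other coordinates are free. *)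
Definition face_points n (a : {ffun 'I_n -> option bool}) :
    {set {ffun 'I_n -> bool}} :=
  [set x : {ffun 'I_n -> bool} |
    [forall i, if a i is Some b then x i == b else true]].

Definition face_dim n (a : {ffun 'I_n -> option bool}) : nat :=
  #|[set i | a i == None]|.

Definition injective_face n (s : singular_cube G n) a : bool :=
  dinjectiveb s (face_points a).

Definition degree n (s : singular_cube G n) : nat :=
  \max_(a | injective_face s a) face_dim a.

Lemma degree_face n (i : 'I_n.+1) b (s : singular_cube G n.+1) :
  (degree (face i b s) <= degree s)%N.
Proof.
apply/bigmax_leqP => a inj_a.
pose a' : {ffun 'I_n.+1 -> option bool} :=
  [ffun j => if unlift i j is Some k then a k else Some b].
have -> : face_dim a = face_dim a'.
  rewrite /face_dim -(card_imset _ (@lift_inj _ i)); apply/eq_card => k.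
  rewrite !inE !ffunE; case: unliftP => [l|] ->.
    by rewrite (mem_imset _ _ (@lift_inj _ i)) inE.
  by apply/imsetP => -[l _ /eqP]; rewrite (negPf (neq_lift _ _)).
have pts x : x \in face_points a' ->
    exists2 y, y \in face_points a & x = insert i b y.
  rewrite inE => /forallP a'x; exists [ffun k => x (lift i k)].
    rewrite inE; apply/forallP => k; have := a'x (lift i k).
    by rewrite !ffunE liftK.
  apply/ffunP => k; rewrite ffunE; case: unliftP => [l|] ->.
    by rewrite ffunE.
  by have := a'x i; rewrite ffunE unlift_none => /eqP.
apply: (leq_bigmax_cond (P := injective_face s)).
apply/dinjectiveP => _ _ /pts[x ax ->] /pts[y ay ->] sxy.
congr (insert i b _); apply: (dinjectiveP _ _ inj_a) => //.
by rewrite /= !ffunE.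
Qed.

Lemma degenerate_face n (s : singular_cube G n.+1) (i : 'I_n.+1) :
    face i false s = face i true s ->
  forall j b, j != i -> degenerate (face j b s).
Proof.
case: n s i => [|n] s i s_i j b ji; first by rewrite !ord1 in ji.
have [|k -> _] := @unlift_some _ i j; first by rewrite eq_sym.
apply/existsP; exists (swap i k).
by rewrite -!faceC s_i.
Qed.

(* Integer-valued functions on the singular n-cubes: as [G] is finite, this is
   the free abelian group on them, with basis the [gen s]. *)
Definition Qn n : zmodType := {ffun singular_cube G n -> int}.

Definition gen n (s : singular_cube G n) : Qn n := [ffun t => (t == s)%:Z].

Definition bd_cube n (s : singular_cube G n.+1) : Qn n :=
  \sum_(i < n.+1) (gen (face i false s) - gen (face i true s)) *~ (-1) ^+ i.+1.

Definition Q_bd n (c : Qn n.+1) : Qn n :=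
  \sum_(s : singular_cube G n.+1) bd_cube s *~ c s.

Fact Q_bd_zmod_morphism n : zmod_morphism (@Q_bd n).
Proof.
move=> c e; rewrite /Q_bd -sumrB; apply: eq_bigr => s _.
by rewrite !ffunE mulrzBr.
Qed.

HB.instance Definition _ n :=
  GRing.isZmodMorphism.Build (Qn n.+1) (Qn n) (@Q_bd n) (@Q_bd_zmod_morphism n).

Lemma Q_bd_gen n (s : singular_cube G n.+1) : Q_bd (gen s) = bd_cube s.
Proof.
rewrite /Q_bd (bigD1 s) //= ffunE eqxx big1 ?addr0 // => t /negPf ts.
by rewrite ffunE ts mulr0z.
Qed.

Lemma gen_sum n (c : Qn n) : c = \sum_s gen s *~ c s.
Proof.
apply/ffunP => t; rewrite sum_ffunE (bigD1 t) //= big1 => [|s /negPf st]; last first.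
  by rewrite ffunMzE ffunE eq_sym st mul0rz.
by rewrite addr0 ffunMzE ffunE eqxx intz.
Qed.


Lemma bd_cubeE n (s : singular_cube G n.+1) :
  bd_cube s = \sum_(p : 'I_n.+1 * bool)
    gen (face p.1 p.2 s) *~ (-1) ^+ (p.1.+1 + p.2).
Proof.
rewrite -(pair_bigA _ (fun (i : 'I_n.+1) (b : bool) =>
  gen (face i b s) *~ (-1) ^+ (i.+1 + b))) /=.
apply: eq_bigr => i _; rewrite big_bool /= addn0 addn1 addrC.
by rewrite (exprS _ i.+1) mulN1r mulrNz mulrzBl.
Qed.

Lemma bd_cubeK n (s : singular_cube G n.+2) : Q_bd (bd_cube s) = 0.
Proof.
pose F (p : ('I_n.+2 * bool) * ('I_n.+1 * bool)) : Qn n :=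
  gen (face p.2.1 p.2.2 (face p.1.1 p.1.2 s)) *~
    ((-1) ^+ (p.2.1.+1 + p.2.2) * (-1) ^+ (p.1.1.+1 + p.1.2)).
have -> : Q_bd (bd_cube s) = \sum_p F p.
  rewrite bd_cubeE (raddf_sum (@Q_bd n)) /= -(pair_bigA _ (fun p q => F (p, q))) /=.
  apply: eq_bigr => p _; rewrite raddfMz /= Q_bd_gen bd_cubeE.
  by rewrite mulrz_suml; apply: eq_bigr => q _; rewrite -mulrzA.
pose h (p : ('I_n.+2 * bool) * ('I_n.+1 * bool)) :=
  ((lift p.1.1 p.2.1, p.2.2), (swap p.1.1 p.2.1, p.1.2)).
have hK : involutive h by case=> [[i a] [j b]]; rewrite /h /= lift_swap swapK.
have Fh p : F (h p) = - F p.
  case: p => [[i a] [j b]]; rewrite /F /h -[RHS]mulrNz /= -faceC.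
  congr (_ *~ _); rewrite -!exprD -[LHS]signr_odd -[in RHS]signr_odd -signrN.
  congr (_ ^+ nat_of_bool _); have := swap_sign i j;
  rewrite /= /bump !(oddD, oddS, oddb).
  by case: (i <= j)%N; case: (odd i); case: (odd j); case: (odd (swap i j));
     case: a; case: b.
set S := \sum_p F p.
have SN : S = - S.
  rewrite {1}/S (reindex_inj (inv_inj hK)) /= -sumrN.
  by apply: eq_bigr => p _.
apply/ffunP => t; move: (S) SN => {}S /ffunP/(_ t).
by rewrite !ffunE; move: (S t) => z; lia.
Qed.

Fact Q_bdK n (c : Qn n.+2) : Q_bd (Q_bd c) = 0.
Proof.
rewrite (gen_sum c) (raddf_sum (@Q_bd n.+1)) (raddf_sum (@Q_bd n)) big1 //=.
move=> s _.
by rewrite (raddfMz (@Q_bd n.+1)) (raddfMz (@Q_bd n)) /= Q_bd_gen bd_cubeK mul0rz.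
Qed.

Definition Q : chain_complex := ChainComplex Q_bdK.

Definition D_part n : zmodClosed (Q n) :=
  generated (fun c : Qn n => exists2 s, degenerate s & c = gen s).

Fact D_part_bd n x : x \in D_part n.+1 -> bd Q n x \in D_part n.
Proof.
apply: generated_map => _ [s /existsP[i /eqP s_i] ->] /=.
rewrite Q_bd_gen; apply: rpred_sum => j _; apply: rpredMz.
have [->|ji] := eqVneq j i; first by rewrite s_i subrr rpred0.
have gen_face b : gen (face j b s) \in D_part n.
  by apply: mem_generated; exists (face j b s) => //;
     apply: degenerate_face s_i _ _ ji.
exact: rpredB.
Qed.

Definition D : subcomplex Q := Subcomplex D_part_bd.

Definition C : chain_complex := quot_complex D.

Definition cls n (s : singular_cube G n) : C n :=
  (\pi_(Quotient.quot (D n)) (gen s))%qT.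

(* [C_lt k] is generated by the nondegenerate cubes of degree less than k, so
   that C^k is [C_lt k.+1], C^(k-1) is [C_lt k], and C^(-1) = [C_lt 0] is 0. *)
Definition C_lt_part k n : zmodClosed (C n) :=
  generated (fun c : C n =>
    exists2 s, ~~ degenerate s && (degree s < k)%N & c = cls s).

Lemma cls_C_lt k n (s : singular_cube G n) :
  (degree s < k)%N -> cls s \in C_lt_part k n.
Proof.
move=> s_k; case: (boolP (degenerate s)) => s_deg; last first.
  by apply: mem_generated; exists s; rewrite ?s_deg.
suff -> : cls s = 0 by rewrite rpred0.
rewrite /cls; apply/eqP; rewrite -[0](raddf0 (\pi_(Quotient.quot (D n)))%qT).
by rewrite -Quotient.idealrBE subr0; apply: mem_generated; exists s.
Qed.

Fact C_lt_part_bd k n x : x \in C_lt_part k n.+1 -> bd C n x \in C_lt_part k n.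
Proof.
apply: generated_map => _ [s /andP[_ s_k] ->] /=.
rewrite /cls quot_bd_pi /= Q_bd_gen raddf_sum; apply: rpred_sum => i _.
rewrite raddfMz; apply: rpredMz; rewrite raddfB.
by apply: rpredB; apply: cls_C_lt; apply: leq_ltn_trans s_k; apply: degree_face.
Qed.

Definition C_lt k : subcomplex C := Subcomplex (@C_lt_part_bd k).

Definition C_deg k : chain_complex :=
  quot_complex (restrict (C_lt k.+1) (C_lt k)).

End Faces.

Definition H (n : nat) (G : graph) : zmodType := homology n (C G).

Definition H_deg (k n : nat) (G : graph) : zmodType := homology n (C_deg G k).

(* Main.v *)
(* Greene spheres are bipartite and, for n >= 4, admit no injective 3-cube: such
   a cube would contain, with a vertex of the cycle, its three neighbours, hence
   the whole graph, which has more than 8 vertices. So all cubes have degree at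
   most 2, and H_3 = H_3^[2] follows from the exactness of C^1 in dimensions 2
   and 3.

   A non-injective square in a bipartite graph bounds in the graph, so the image
   of a cube of degree at most 1 and dimension at most 3 is a tree. Chains
   carried by a tree are exact in positive dimensions (fold the leaves one by
   one), and C^1 is exact in dimensions 2 and 3 by the method of acyclic carriers.

   For H_2, the graph is a quadrangulation of the 2-sphere with one face around
   each vertex j of the cycle. The degree of a 2-chain over that face is an
   additive function; for a cycle, the degrees over consecutive faces are
   opposite, so that they vanish simultaneously. They vanish on boundaries, since
   a 3-cube has too few vertices to cover the sphere. Modulo boundaries and C^1,
   every square is an integer multiple of a face, so a cycle of degree 0 is a
   cycle of C^1, hence a boundary; the alternating sum of the faces, corrected by
   squares of degree 1, is a cycle of degree 1. *)
Require Import Defs.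
From HB Require Import structures.
From mathcomp Require Import all_boot all_order all_algebra.
From mathcomp Require Import boolp zify.

Set Implicit Arguments.
Unset Strict Implicit.
Unset Printing Implicit Defensive.

Import GRing.Theory.
Local Open Scope ring_scope.

(** * Quotients of abelian groups *)

Lemma bijective_of (U : eqType) (W : Type) (f : U -> W) :
  injective f -> (forall w, exists x, f x = w) -> bijective f.
Proof.
move=> f_inj f_surj; have [g fg] := choice f_surj.
by exists g => // x; apply: f_inj; rewrite fg.
Qed.

Section Induced.
Variables (V W : zmodType) (Q : zmodClosed V) (f : {additive V -> W}).
Hypothesis fQ : forall x, x \in Q -> f x = 0.

(** The [let] makes [induced] depend on [fQ], so that the additive structure, which rests on [fQ],
    can be attached to it. *)
Definition induced (q : Quotient.quot Q) : W := let _ := fQ in f (repr q).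

Lemma induced_pi x : induced (\pi_(Quotient.quot Q) x)%qT = f x.
Proof.
apply/eqP; rewrite /induced -subr_eq0 -raddfB; apply/eqP/fQ.
by rewrite Quotient.idealrBE reprK.
Qed.

Fact induced_zmod_morphism : zmod_morphism induced.
Proof.
by move=> x y; rewrite -[x]reprK -[y]reprK -raddfB !induced_pi raddfB.
Qed.

HB.instance Definition _ :=
  GRing.isZmodMorphism.Build (Quotient.quot Q) W induced induced_zmod_morphism.
End Induced.

Lemma pi_eq0 (V : zmodType) (Q : zmodClosed V) (x : V) :
  (\pi_(Quotient.quot Q) x == 0)%qT = (x \in Q).
Proof.
by rewrite -[0](raddf0 (\pi_(Quotient.quot Q))%qT) -Quotient.idealrBE subr0.
Qed.

(** The first isomorphism theorem in the form used for homology: [f] is given on cycles, and its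
    kernel is compared with the boundaries. *)
Lemma isomorphic_subquotient (V W : zmodType) (P Q : zmodClosed V)
    (f : {additive subgroup P -> W}) :
  (forall x, f x = 0 <-> \val x \in Q) -> (forall w, exists x, f x = w) ->
  isomorphic (subquotient P Q) W.
Proof.
move=> f0 f_surj.
have fQ x : x \in preim_group (\val : subgroup P -> V) Q -> f x = 0.
  by move=> xQ; apply/f0.
have ker0 (q : subquotient P Q) : induced fQ q = 0 -> q = 0.
  rewrite -[q]reprK; move: (repr q) => x; rewrite induced_pi => /f0 x0.
  by apply/eqP; rewrite pi_eq0.
exists (induced fQ); apply: bijective_of => [q r /eqP|w].
- by rewrite -subr_eq0 -raddfB => /eqP/ker0/eqP; rewrite subr_eq0 => /eqP.
- by have [x <-] := f_surj w;
  exists (\pi_(Quotient.quot (preim_group (\val : subgroup P -> V) Q)) x)%qT;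
    rewrite /= induced_pi.
Qed.

Section GeneratedInd.
Variables (V : zmodType) (S P : V -> Prop).
Hypotheses (P0 : P 0) (PB : forall x y, P x -> P y -> P (x - y)).

Let good : {pred V} := fun x => `[< P x >].

Fact good_closed : zmod_closed good.
Proof.
split; first exact/asboolP.
by move=> x y /asboolP Px /asboolP Py; apply/asboolP/PB.
Qed.

HB.instance Definition _ := GRing.isZmodClosed.Build V good good_closed.

(** Made boolean, [P] is itself a closed predicate, hence one of those over which [generated]
    quantifies. *)
Lemma generated_ind x : (forall s, S s -> P s) -> x \in generated S -> P x.
Proof.
move=> SP Sx; apply/asboolP; change (x \in good).
by apply: generated_sub Sx => s /SP ?; apply/asboolP.
Qed.
End GeneratedInd.

(** * Normalized chains and linear extension of maps on cubes *)

Section Chains.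
Variable G : graph.

(** The [gen s] form a basis, so the span of some of them is cut out by the vanishing of the other
    coefficients. This makes [lin] independent of representatives. *)
Lemma D_partP n (c : Qn G n) :
  reflect (forall s, ~~ degenerate s -> c s = 0) (c \in D_part G n).
Proof.
apply: (iffP idP) => [|c0].
  apply: (generated_ind (P := fun c : Qn G n => forall s, ~~ degenerate s -> c s = 0))
    => [s _|x y x0 y0 s s_nd|_ [t t_d ->] s s_nd].
  - by rewrite ffunE.
  - by rewrite !ffunE x0 ?y0.
  - by rewrite ffunE; case: eqVneq s_nd => // ->; rewrite t_d.
rewrite (gen_sum c); apply: rpred_sum => s _.
have [s_d|s_nd] := boolP (degenerate s); last by rewrite c0 // mulr0z rpred0.
by apply/rpredMz/mem_generated; exists s.
Qed.

Lemma cls_degenerate n (s : singular_cube G n) : degenerate s -> cls s = 0.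
Proof. by move=> s_d; apply/eqP; rewrite pi_eq0; apply: mem_generated; exists s. Qed.

Lemma chain_sum n (x : C G n) :
  x = \sum_(s : singular_cube G n | ~~ degenerate s) cls s *~ (repr x : Qn G n) s.
Proof.
rewrite -{1}[x]reprK {1}(gen_sum (repr x)) raddf_sum (bigID (@degenerate G n)) /=.
have pi_gen s k : (\pi_(Quotient.quot (D G n)) (gen s *~ k))%qT = cls s *~ k.
  exact: (raddfMz (\pi_(Quotient.quot (D G n)))%qT).
rewrite big1 => [|s s_d]; last by rewrite pi_gen cls_degenerate // mul0rz.
by rewrite add0r; apply: eq_bigr => s _; rewrite pi_gen.
Qed.

Lemma chain_ind n (P : C G n -> Prop) :
  P 0 -> (forall x y, P x -> P y -> P (x - y)) ->
  (forall s, ~~ degenerate s -> P (cls s)) -> forall x, P x.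
Proof.
move=> P0 PB Pcls x.
apply: (generated_ind (S := fun c =>
  exists2 s, ~~ degenerate s & c = cls s)) P0 PB _ _ _.
  by move=> _ [s s_nd ->]; apply: Pcls.
rewrite (chain_sum x); apply: rpred_sum => s s_nd.
by apply/rpredMz/mem_generated; exists s.
Qed.

Section Lin.
Variables (W : zmodType) (n : nat) (F : singular_cube G n -> W).

(** The linear extension of [F] to [C]. Summing over nondegenerate cubes only makes it well defined
    whatever values [F] takes on degenerate ones. *)
Definition lin (x : C G n) : W :=
  \sum_(s : singular_cube G n | ~~ degenerate s) F s *~ (repr x : Qn G n) s.

Lemma lin_pi (c : Qn G n) :
  lin (\pi_(Quotient.quot (D G n)) c)%qT =
  \sum_(s : singular_cube G n | ~~ degenerate s) F s *~ c s.
Proof.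
apply: eq_bigr => s s_nd; congr (_ *~ _).
have : repr (\pi_(Quotient.quot (D G n)) c)%qT - c \in D_part G n.
  by rewrite [_ \in _]Quotient.idealrBE reprK.
by move=> /D_partP/(_ s s_nd)/eqP; rewrite !ffunE subr_eq0 => /eqP.
Qed.

Fact lin_zmod_morphism : zmod_morphism lin.
Proof.
move=> x y; rewrite -[x]reprK -[y]reprK -raddfB !lin_pi -sumrB.
by apply: eq_bigr => s _; rewrite !ffunE mulrzBr.
Qed.

HB.instance Definition _ :=
  GRing.isZmodMorphism.Build (C G n) W lin lin_zmod_morphism.

Lemma lin_cls s : lin (cls s) = if degenerate s then 0 else F s.
Proof.
have [/cls_degenerate->|s_nd] := ifPn; first exact: raddf0.
rewrite lin_pi (bigD1 s) //= ffunE eqxx big1 ?addr0 // => t /andP[_ /negPf ts].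
by rewrite ffunE ts mulr0z.
Qed.
End Lin.
End Chains.

(** * Cubes as functions of their coordinates *)

Section Coordinates.
Variable n : nat.

Definition head (p : {ffun 'I_n.+1 -> bool}) : bool := p ord0.
Definition tail (p : {ffun 'I_n.+1 -> bool}) : {ffun 'I_n -> bool} :=
  [ffun k => p (lift ord0 k)].

Lemma head_insert0 b q : head (insert ord0 b q) = b.
Proof. by rewrite /head ffunE unlift_none. Qed.

Lemma tail_insert0 b q : tail (insert ord0 b q) = q.
Proof. by apply/ffunP => k; rewrite !ffunE liftK. Qed.

Lemma insert_head_tail p : insert ord0 (head p) (tail p) = p.
Proof.
by apply/ffunP => k; rewrite ffunE; case: unliftP => [j|] ->; rewrite ?ffunE.
Qed.
End Coordinates.

Lemma head_insertS n (i : 'I_n.+1) b q : head (insert (lift ord0 i) b q) = head q.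
Proof.
rewrite /head ffunE; case: unliftP => [k k0|/eqP];
  last by rewrite (negPf (neq_lift _ _)).
congr (q _); apply: val_inj; have := congr1 val k0; rewrite /= /bump /=.
by case: leqP => /=; lia.
Qed.

Lemma tail_insertS n (i : 'I_n.+1) b q :
  tail (insert (lift ord0 i) b q) = insert i b (tail q).
Proof.
apply/ffunP => k; rewrite !ffunE.
case: (unliftP i k) => [j ->|->]; last by rewrite unlift_none.
have -> : lift ord0 (lift i j) = lift (lift ord0 i) (lift ord0 j) :> 'I_n.+2.
  by apply: val_inj; rewrite /= /bump /=; lia.
by rewrite liftK ffunE.
Qed.

(** The coordinates where [p] and [q] differ are split into coordinate 0 and the others, which
    allows induction on the dimension. *)
Lemma cube_adjS n (p q : {ffun 'I_n.+1 -> bool}) :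
  cube_adj p q = if head p == head q then cube_adj (tail p) (tail q)
                 else tail p == tail q.
Proof.
rewrite /cube_adj; set A := [set i | p i != q i]; set B := [set i | _].
have -> : #|A| = ((head p != head q) + #|B|)%N.
  rewrite (cardsD1 ord0) inE; congr (_ + _)%N.
  rewrite -(card_imset B (@lift_inj _ ord0)); apply: eq_card => k; rewrite !inE.
  case: (unliftP ord0 k) => [j|] ->.
    by rewrite (mem_imset _ _ (@lift_inj _ ord0)) inE !ffunE.
  by apply/esym/negbTE/imsetP => -[j _ /eqP]; rewrite (negPf (neq_lift _ _)).
case: (head p == head q) => //=; change ((#|B|.+1 == 1)%N = (tail p == tail q));
  rewrite eqSS cards_eq0.
apply/eqP/eqP => [B0|pq]; last by apply/setP => i; rewrite !inE pq eqxx.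
by apply/ffunP => i; have /setP/(_ i) := B0; rewrite !inE => /eqP.
Qed.

Lemma cube_adj_insert n (i : 'I_n.+1) b p q :
  cube_adj p q -> cube_adj (insert i b p) (insert i b q).
Proof.
rewrite /cube_adj => /eqP <-.
rewrite -(card_imset _ (@lift_inj _ i)); apply/eqP/eq_card => k.
rewrite !inE !ffunE; case: unliftP => [l|] ->.
  by rewrite (mem_imset _ _ (@lift_inj _ i)) inE.
by rewrite eqxx; apply/esym/imsetP => -[l _ /eqP]; rewrite (negPf (neq_lift _ _)).
Qed.

Section Along.
Variables (V : eqType) (R : rel V).

(** Graph maps are the case [R = near]. The relation is a parameter so that the same notion
    expresses that a cube runs inside a forest. *)
Definition along n (f : {ffun 'I_n -> bool} -> V) : Prop :=
  forall p q, cube_adj p q -> R (f p) (f q).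

Lemma along_face n (i : 'I_n.+1) b (f : {ffun 'I_n.+1 -> bool} -> V) :
  along f -> along (fun q => f (insert i b q)).
Proof. by move=> fR p q pq; apply/fR/cube_adj_insert. Qed.

Hypothesis R_sym : symmetric R.

Lemma along_cons n (F : bool -> {ffun 'I_n -> bool} -> V) :
  (forall b, along (F b)) -> (forall t, R (F false t) (F true t)) ->
  along (fun p : {ffun 'I_n.+1 -> bool} => F (head p) (tail p)).
Proof.
move=> FR F01 p q; rewrite cube_adjS; case: eqP => [->|]; first exact: FR.
move=> pq /eqP ->; case: (head p) (head q) pq => [] [] // _.
by rewrite R_sym.
Qed.

Lemma along0 (f : {ffun 'I_0 -> bool} -> V) : along f.
Proof.
by move=> p q; have -> : p = q; [apply/ffunP => -[]|rewrite (cube_adj_irr q)].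
Qed.
End Along.

Lemma sub_along (V : eqType) (R S : rel V) n (f : {ffun 'I_n -> bool} -> V) :
  subrel R S -> along R f -> along S f.
Proof. by move=> RS fR p q /fR/RS. Qed.

(** * Classes of cubes and chains carried by a relation *)

Section Cubes.
Variable G : graph.

Definition near (x y : G) : bool := adj x y || (x == y).

Lemma near_sym : symmetric near.
Proof. by move=> x y; rewrite /near adj_sym eq_sym. Qed.

Lemma is_graph_mapP n (f : {ffun 'I_n -> bool} -> G) :
  reflect (along near f) (is_graph_map (G := cube_graph n) f).
Proof.
apply: (iffP forallP) => [fG p q pq|fG p]; last first.
  by apply/forallP => q; apply/implyP; apply: fG.
by have /forallP/(_ q)/implyP := fG p; apply.
Qed.

Lemma along_cube n (s : singular_cube G n) : along near s.
Proof. exact/is_graph_mapP/graph_funP. Qed.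

(* The class of [f], or [0] if [f] is not a graph map. *)
Definition cube_class n (f : {ffun 'I_n -> bool} -> G) : C G n :=
  if insub (finfun f : {ffun cube_graph n -> G}) is Some s
  then cls (s : singular_cube G n) else 0.

Lemma cube_class_cls n (s : singular_cube G n) f : f =1 s -> cube_class f = cls s.
Proof.
move=> fs; rewrite /cube_class; have -> : finfun f = val s by apply/ffunP => p;
  rewrite ffunE fs.
by rewrite valK.
Qed.

Lemma cube_classP n (f : {ffun 'I_n -> bool} -> G) :
  along near f -> exists2 s : singular_cube G n, f =1 s & cube_class f = cls s.
Proof.
move=> f_near; have fG : is_graph_map (G := cube_graph n) (finfun f).
  by apply/is_graph_mapP => p q pq; rewrite !ffunE; apply: f_near.
have fs : f =1 GraphMap fG by move=> p; rewrite /= ffunE.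
by exists (GraphMap fG) => //; apply: cube_class_cls.
Qed.

Lemma eq_cube_class n (f g : {ffun 'I_n -> bool} -> G) : f =1 g -> cube_class f =
  cube_class g.
Proof. by move=> fg; rewrite /cube_class (eq_ffun _ fg). Qed.

Lemma cube_class_degenerate n (i : 'I_n.+1) (f : {ffun 'I_n.+1 -> bool} -> G) :
  (forall q, f (insert i false q) = f (insert i true q)) -> cube_class f = 0.
Proof.
rewrite /cube_class; case: insubP => // s _ sf fi; apply: cls_degenerate.
apply/existsP; exists i; apply/eqP/val_inj/ffunP => q.
rewrite !ffunE; have sE p : s p = f p by rewrite -[RHS](ffunE f) -sf.
by rewrite !sE fi.
Qed.

Lemma bd_cls n (s : singular_cube G n.+1) :
  bd (C G) n (cls s) =
  \sum_(i < n.+1) (cls (face i false s) - cls (face i true s)) *~ (-1) ^+ i.+1.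
Proof.
rewrite /= quot_bd_pi /= Q_bd_gen /bd_cube raddf_sum; apply: eq_bigr => i _.
by rewrite (raddfMz (\pi_(Quotient.quot (D G n)))%qT) raddfB.
Qed.

Lemma bd_cube_class n (f : {ffun 'I_n.+1 -> bool} -> G) : along near f ->
  bd (C G) n (cube_class f) =
  \sum_(i < n.+1) (cube_class (fun q => f (insert i false q)) -
                   cube_class (fun q => f (insert i true q))) *~ (-1) ^+ i.+1.
Proof.
move=> /cube_classP[s fs ->]; rewrite bd_cls; apply: eq_bigr => i _.
by congr ((_ - _) *~ _); apply/esym/cube_class_cls => q; rewrite /= ffunE fs.
Qed.

Lemma bdB n (x y : C G n.+1) : bd (C G) n (x - y) = bd (C G) n x - bd (C G) n y.
Proof. exact: raddfB. Qed.

Lemma bd0 n : bd (C G) n 0 = 0.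
Proof. exact: raddf0. Qed.

Section Carried.
Variable (R : rel G).

Definition carried n : zmodClosed (C G n) :=
  generated (fun c : C G n => exists2 s : singular_cube G n, along R s & c = cls s).

Lemma carried_cls n (s : singular_cube G n) : along R s -> cls s \in carried n.
Proof. by move=> sR; apply: mem_generated; exists s. Qed.

(** If [f] is not a graph map, its class is the default [0], which lies in every subgroup. *)
Lemma carried_cube_class n (f : {ffun 'I_n -> bool} -> G) :
  along R f -> cube_class f \in carried n.
Proof.
move=> fR; rewrite /cube_class; case: insubP => [s _ sf|_]; last exact: rpred0.
apply: carried_cls => p q pq; have sE x : s x = f x by rewrite -[RHS](ffunE f) -sf.
by rewrite !sE; apply: fR.
Qed.

Lemma carried_ind n (P : C G n -> Prop) :
  P 0 -> (forall x y, P x -> P y -> P (x - y)) ->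
  (forall s : singular_cube G n, along R s -> P (cls s)) ->
  forall x, x \in carried n -> P x.
Proof.
move=> P0 PB Ps x; apply: (generated_ind P0 PB) => _ [s sR ->]; exact: Ps.
Qed.
End Carried.

Lemma sub_carried (R S : rel G) n x :
  subrel R S -> x \in carried R n -> x \in carried S n.
Proof.
move=> RS; apply: generated_sub => _ [s sR ->].
exact/carried_cls/(sub_along RS sR).
Qed.

(** The new coordinate 0 is the time of the homotopy from [s] to [phi \o s]. The body is written in
    the shape expected by [along_cons]. *)
Definition homotopy_cube (phi : G -> G) n (s : {ffun 'I_n -> bool} -> G) :=
  fun p : {ffun 'I_n.+1 -> bool} =>
    (fun b t => if b then phi (s t) else s t) (head p) (tail p).

(** * The prism operator of a homotopy from the identity to [phi] *)

Section Homotopy.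
Variables (R S : rel G) (phi : G -> G).
Hypotheses (R_sym : symmetric R) (R_near : subrel R near) (S_near : subrel S near).
Hypothesis R_phi : forall x y, R x y -> S (phi x) (phi y).
Hypothesis phiR : forall x, R x (phi x).
Hypothesis SR : subrel S R.

Definition push n : C G n -> C G n := lin (fun s => cube_class (phi \o s)).
Definition prism n : C G n -> C G n.+1 := lin (fun s =>
  cube_class (homotopy_cube phi s)).

HB.instance Definition _ n :=
  GRing.isZmodMorphism.Build (C G n) (C G n) (@push n) (lin_zmod_morphism _).
HB.instance Definition _ n :=
  GRing.isZmodMorphism.Build (C G n) (C G n.+1) (@prism n) (lin_zmod_morphism _).

#[local] Opaque C push prism cube_class cls.

Let along_homotopy n (s : {ffun 'I_n -> bool} -> G) : along R s -> along R
  (homotopy_cube phi s).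
Proof.
move=> sR; apply: along_cons => // -[]; last exact: sR.
by move=> p q pq; apply/SR/R_phi/sR.
Qed.

(** An equality of opposite faces of [s] survives composition with [phi], so for degenerate [s] both
    sides vanish. *)
Let push_cls n (s : singular_cube G n) : push (cls s) = cube_class (phi \o s).
Proof.
rewrite [LHS]lin_cls; case: ifP => //; case: n s => // n s /existsP[i /eqP sd].
apply/esym/(cube_class_degenerate (i := i)) => q /=; congr (phi _).
by have /(congr1 (fun s : singular_cube G n => s q)) := sd; rewrite /= !ffunE.
Qed.

Let prism_cls n (s : singular_cube G n) :
  prism (cls s) = cube_class (homotopy_cube phi s).
Proof.
rewrite [LHS]lin_cls; case: ifP => //; case: n s => // n s /existsP[i /eqP sd].
apply/esym/(cube_class_degenerate (i := lift ord0 i)) => q.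
rewrite /homotopy_cube !head_insertS !tail_insertS.
have /(congr1 (fun s : singular_cube G n => s (tail q))) := sd.
by rewrite /= !ffunE => ->.
Qed.

Lemma push_carried n x : x \in carried R n -> push x \in carried S n.
Proof.
apply: generated_map => _ [s sR ->]; rewrite /= push_cls; apply: carried_cube_class.
by move=> p q /sR/R_phi.
Qed.

Lemma prism_carried n x : x \in carried R n -> prism x \in carried R n.+1.
Proof.
apply: generated_map => _ [s sR ->]; rewrite /= prism_cls.
exact/carried_cube_class/along_homotopy.
Qed.

Let pushB n x y : @push n (x - y) = push x - push y.
Proof. exact: raddfB. Qed.

Let prismB n x y : @prism n (x - y) = prism x - prism y.
Proof. exact: raddfB. Qed.

Lemma push_bd n x : x \in carried R n.+1 -> bd (C G) n (push x) = push (bd (C G) n x).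
Proof.
apply: (carried_ind (P := fun x => bd (C G) n (push x) = push (bd (C G) n x))) => {x}.
- by rewrite (raddf0 (@push _)) !bd0 (raddf0 (@push _)).
- by move=> x y xE yE; rewrite bdB !pushB bdB xE yE.
move=> s sR; rewrite push_cls bd_cube_class; last first.
  by move=> p q /sR/R_phi/S_near.
rewrite bd_cls (raddf_sum (@push _)); apply: eq_bigr => i _.
rewrite (raddfMz (@push _)) /= pushB !push_cls.
have E b : cube_class (phi \o face i b s) = cube_class (fun q =>
  (phi \o s) (insert i b q)).
  by apply: eq_cube_class => q; rewrite /= ffunE.
by rewrite !E.
Qed.

(** The two faces in direction 0 give [push x - x]. The other faces are the prisms over the faces of
    the cube, with their directions, hence their signs, shifted by one. *)
Lemma prism_bd n x : x \in carried R n.+1 ->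
  bd (C G) n.+1 (prism x) = push x - x - prism (bd (C G) n x).
Proof.
apply: (carried_ind (P := fun x =>
  bd (C G) n.+1 (prism x) = push x - x - prism (bd (C G) n x))) => {x}.
- by rewrite (raddf0 (@prism _)) (raddf0 (@push _)) !bd0 (raddf0 (@prism _)) !subr0.
- move=> x y xE yE; rewrite prismB pushB !bdB prismB xE yE.
  rewrite (opprD (_ - _)) addrACA -opprD; congr (_ - _).
  by rewrite opprD addrACA -opprD.
move=> s sR; rewrite prism_cls bd_cube_class;
  last exact/(sub_along R_near)/along_homotopy.
rewrite big_ord_recl /= expr1 mulrN1z opprB.
have -> : cube_class (fun q => homotopy_cube phi s (insert ord0 true q)) = push (cls s).
  rewrite push_cls; apply: eq_cube_class => q.
  by rewrite /homotopy_cube head_insert0 tail_insert0.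
have -> : cube_class (fun q => homotopy_cube phi s (insert ord0 false q)) = cls s.
  by apply: cube_class_cls => q; rewrite /homotopy_cube head_insert0 tail_insert0.
congr (_ + _); rewrite bd_cls (raddf_sum (@prism _)) -sumrN; apply: eq_bigr => i _.
rewrite (raddfMz (@prism n)) /= prismB !prism_cls exprS mulN1r mulrNz.
have E b : cube_class (homotopy_cube phi (face i b s)) =
           cube_class (fun q => homotopy_cube phi s (insert (lift ord0 i) b q)).
  apply: eq_cube_class => q.
  by rewrite /homotopy_cube head_insertS tail_insertS /= ffunE.
by rewrite !E.
Qed.
End Homotopy.
End Cubes.

(** * Chains carried by a forest *)

Section Forest.
Variable V : eqType.
Implicit Type l : seq (V * V).

Definition link l : rel V := fun x y => [|| x == y, (x, y) \in l | (y, x) \in l].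

Lemma link_sym l : symmetric (link l).
Proof. by move=> x y; rewrite /link eq_sym [X in _ || X]orbC. Qed.

Lemma linkxx l x : link l x x.
Proof. by rewrite /link eqxx. Qed.

(* Each pair joins a new leaf to a vertex, so the list is built from its tail. *)
Fixpoint forest l : bool :=
  if l is (w, v) :: l' then
    [&& w != v, all (fun e => (w != e.1) && (w != e.2)) l' & forest l']
  else true.

Lemma link_leaf w v l x : forest ((w, v) :: l) ->
  link ((w, v) :: l) w x -> (x == w) || (x == v).
Proof.
case/and3P=> wv /allP wl _; rewrite /link !inE !xpair_eqE eqxx (negPf wv) andbF /=.
rewrite eq_sym; case/or3P=> [->//|/orP[->|wx]|wx]; rewrite ?orbT //.
- by have := wl _ wx; rewrite /= eqxx.
- by have := wl _ wx; rewrite /= eqxx andbF.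
Qed.

Lemma link_other w v l x y :
  x != w -> y != w -> link ((w, v) :: l) x y -> link l x y.
Proof.
by rewrite /link !inE !xpair_eqE => /negPf-> /negPf->.
Qed.

(** The last leaf [w] is linked only to itself and [v], so it cannot lie between two distinct other
    vertices. A square thus avoids [w] and descends to the smaller forest. *)
Lemma forest_no_square l a b c d : forest l ->
  link l a b -> link l b d -> link l d c -> link l c a -> uniq [:: a; b; c; d] -> False.
Proof.
elim: l => [|[w v] l IHl] l_forest.
  by rewrite /link /= !orbF => /eqP->; rewrite !inE eqxx.
have leaf x y z : x != w -> z != w -> x != z ->
    link ((w, v) :: l) x y -> link ((w, v) :: l) y z -> y != w.
  move=> xw zw xz; rewrite link_sym; case: eqVneq => // -> wx wz.
  have := link_leaf l_forest wx; have := link_leaf l_forest wz.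
  by rewrite (negPf xw) (negPf zw) /= => /eqP zv; rewrite -zv (negPf xz).
have forest_l : forest l by case/and3P: l_forest.
move=> ab bd dc ca /= abcd; move: (abcd); rewrite !inE !negb_or.
case/and4P=> /and3P[nab nac nad] /andP[nbc nbd] ncd _.
have aw : a != w.
  case: (eqVneq a w) => // aw; move: ab ca; rewrite link_sym aw [link _ c _]link_sym.
  move=> ab ca; have := leaf b w c; rewrite eqxx -aw eq_sym nab eq_sym nac nbc aw.
  by move=> /(_ isT isT isT ab ca).
have dw : d != w.
  case: (eqVneq d w) => // dw; rewrite dw in bd dc.
  by have := leaf b w c; rewrite eqxx -dw nbd ncd nbc dw => /(_ isT isT isT bd dc).
have bw : b != w by apply: leaf ab bd.
have cw : c != w by apply: leaf dc ca; rewrite // eq_sym.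
by apply: IHl => //; apply: link_other; eassumption.
Qed.
End Forest.

Section ForestAcyclic.
Variable G : graph.
Implicit Type l : seq (G * G).

Definition in_graph l := all (fun e => adj e.1 e.2) l.

Lemma link_near l : in_graph l -> subrel (link l) (@near G).
Proof.
move=> /allP lG x y; rewrite /near; case/or3P=> [->|/lG/= ->|/lG/=]; rewrite ?orbT //.
by rewrite adj_sym => ->.
Qed.

Lemma along_eq n (s : {ffun 'I_n -> bool} -> G) : along eq_op s -> forall p q, s p =
  s q.
Proof.
elim: n s => [|n IHn] s s_eq p q; first by congr (s _); apply/ffunP => -[].
rewrite -[p]insert_head_tail -[q]insert_head_tail.
have E b := IHn _ (along_face ord0 b s_eq).
have H t : s (insert ord0 false t) = s (insert ord0 true t).
  apply/eqP/s_eq; rewrite cube_adjS !head_insert0 /= !tail_insert0; exact: eqxx.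
suff K b t : s (insert ord0 b t) = s (insert ord0 true (tail q)) by rewrite !K.
by case: b; rewrite ?H; apply: (E true).
Qed.

(* Folding the last leaf [w] onto [v] is homotopic to the identity. *)
Lemma forest_acyclic l n (x : C G n.+1) :
  forest l -> in_graph l -> x \in carried (link l) n.+1 -> bd (C G) n x = 0 ->
  exists2 y, y \in carried (link l) n.+2 & bd (C G) n.+1 y = x.
Proof.
elim: l x => [|[w v] l IHl] x l_forest lG xl dx.
  (* Without edges every carried cube is constant, hence degenerate in positive dimension, so [x] is
     zero. *)
  exists 0; rewrite ?rpred0 // bd0; apply/esym.
  apply: (carried_ind (R := link [::]) (P := fun x => x = 0)) xl => // [y z -> ->|s sl].
    by rewrite subr0.
  apply: cls_degenerate; apply/existsP; exists ord0; apply/eqP/val_inj/ffunP => q.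
  by rewrite !ffunE; apply: along_eq => a b /sl; rewrite /link /= !orbF.
have /= /andP[wv lG'] := lG; have /and3P[_ wl forest_l] := l_forest.
pose phi z := if z == w then v else z.
have phi_link z : link ((w, v) :: l) z (phi z).
  by rewrite /phi; case: eqP => [->|_]; rewrite ?linkxx // /link inE eqxx orbT.
have sub_l : subrel (link l) (link ((w, v) :: l)).
  by move=> a b; rewrite /link !inE; case/or3P=> ->; rewrite ?orbT.
have link_phi a b : link ((w, v) :: l) a b -> link l (phi a) (phi b).
  rewrite /phi; case: eqP => [-> /(link_leaf l_forest)|/eqP aw].
    case/orP=> /eqP->; first by rewrite eqxx linkxx.
    by case: ifP; rewrite linkxx.
  case: eqP => [->|/eqP bw]; last exact: link_other.
  by rewrite link_sym => /(link_leaf l_forest); rewrite (negPf aw) => /eqP->;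
    apply: linkxx.
have dpush : bd (C G) n (push phi x) = 0.
  rewrite (push_bd (R := link ((w, v) :: l)) (S := link l)) ?dx //;
    last exact: link_near.
  exact: (raddf0 (@push _ _ _)).
have pushl := push_carried link_phi xl.
have [y yl dy] := IHl _ forest_l lG' pushl dpush.
(* As [x] is a cycle, the prism bounds [push phi x - x], while [y] bounds [push phi x]. *)
exists (y - prism phi x).
  apply: rpredB; first exact: sub_carried sub_l yl.
  exact: (prism_carried (@link_sym _ _) link_phi phi_link sub_l xl).
rewrite bdB dy (prism_bd (S := link l) (@link_sym _ _) (link_near lG) link_phi
  phi_link sub_l xl).
by rewrite dx (raddf0 (@prism _ _ _)) subr0 opprB addrCA subrr addr0.
Qed.
End ForestAcyclic.

(** * The image of a 3-cube of degree at most 1 *)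

Section NullSquares.
Variable V : eqType.

(* The squares whose boundary walk is null-homotopic in a triangle-free graph. *)
Definition null_square (S : bool -> bool -> V) : bool :=
  [|| S false false == S true true, S true false == S false true,
      (S false false == S true false) && (S false true == S true true)
    | (S false false == S false true) && (S true false == S true true)].

Definition null_cube (F : bool -> bool -> bool -> V) : bool :=
  all (fun b => [&& null_square (F b), null_square (fun x => F x b)
                  & null_square (fun x y => F x y b)]) [:: false; true].

Definition image_edges (F : bool -> bool -> bool -> V) : seq (V * V) :=
  flatten [seq [:: (F b c false, F b c true); (F b false c, F b true c);
                   (F false b c, F true b c)]
          | b <- [:: false; true], c <- [:: false; true]].

(** No closed walk of three nontrivial edges, tested on the list closed under reversal. The filter
    and the [if] prune the search when it is evaluated on all patterns. *)
Definition triangle_free (es : seq (V * V)) : bool :=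
  let es := es ++ [seq (e.2, e.1) | e <- es] in
  all (fun e => all (fun f => if e.2 == f.1 then
    all (fun g => [|| f.1 == f.2, g.1 == g.2, f.2 != g.1 | g.2 != e.1]) es
    else true) es) [seq e <- es | e.1 != e.2].

(* Greedily extends the forest [l] by the pairs in [es]. *)
Fixpoint grow (l es : seq (V * V)) : option (seq (V * V)) :=
  if es is (y, x) :: es' then
    if link l y x then grow l es'
    else if all (fun e => (x != e.1) && (x != e.2)) l then grow ((x, y) :: l) es'
    else if all (fun e => (y != e.1) && (y != e.2)) l then grow ((y, x) :: l) es'
    else None
  else Some l.

(** The failed [link] test makes the two ends of a pair distinct, and the end found absent from [l]
    becomes the new leaf. The last clause records that all pairs come from the data, up to
    reversal. *)
Lemma growP l es l' : grow l es = Some l' -> forest l ->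
  [/\ forest l', all (fun e => link l' e.1 e.2) es, {subset l <= l'} &
      {in l', forall e, [|| e \in l, e \in es | (e.2, e.1) \in es]}].
Proof.
elim: es l => [l [<-] l_f|[y x] es IHes l] /=.
  by split=> // e ->.
have link_cons (m : seq (V * V)) : {subset m <= l'} -> link m y x -> link l' y x.
  by move=> ml; rewrite /link; case/or3P=> [->//|/ml->|/ml->]; rewrite ?orbT.
case: ifP => [yx|nyx].
  move=> /IHes{IHes} IH /IH[l'_f es_l' ll' sub]; split=> //.
    by rewrite es_l' andbT; apply: link_cons ll' yx.
  by move=> e /sub/or3P[] eI; rewrite ?inE eI ?orbT.
have nE : y != x by apply/negP => yx; rewrite /link yx in nyx.
case: ifP => [xl|_]; [|case: ifP => // yl];
  move=> /IHes{IHes}/= IH l_f; move: IH;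
  rewrite ?[x == y]eq_sym nE l_f ?xl ?yl => /(_ isT)[l'_f es_l' ll' sub]; split=> //.
- rewrite es_l' andbT; apply: link_cons ll' _.
  by rewrite /link !inE eqxx !orbT.
- by move=> e el; apply: ll'; rewrite inE el orbT.
- by move=> e /sub; rewrite !inE => /or3P[/orP[/eqP->|->]|->|->]; rewrite ?eqxx ?orbT.
- rewrite es_l' andbT; apply: link_cons ll' _.
  by rewrite /link !inE eqxx !orbT.
- by move=> e el; apply: ll'; rewrite inE el orbT.
- by move=> e /sub; rewrite !inE => /or3P[/orP[/eqP->|->]|->|->]; rewrite ?eqxx ?orbT.
Qed.
End NullSquares.

(** * Reduction to finitely many patterns *)

Section GrowMap.
Variables (U V : eqType) (g : U -> V) (A : {pred U}).
Hypothesis g_inj : {in A &, injective g}.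
Let gg (e : U * U) : V * V := (g e.1, g e.2).
Let onA (l : seq (U * U)) := all (fun e => (e.1 \in A) && (e.2 \in A)) l.

(** [grow] inspects vertices only through equality tests, so it commutes with a renaming that is
    injective on the vertices present. *)
Lemma grow_map l es : onA l -> onA es ->
  grow (map gg l) (map gg es) = omap (map gg) (grow l es).
Proof.
elim: es l => //= -[y x] es IHes l lA /= /andP[/andP[yA xA] esA].
have gE : {in A &, forall a b, (g a == g b) = (a == b)} by exact: inj_in_eq.
have memE a b : a \in A -> b \in A -> ((g a, g b) \in map gg l) = ((a, b) \in l).
  move=> aA bA; apply/mapP/idP => [[[c d] cdl /= [ac bd]]|abl]; last by exists (a, b).
  have /andP[/= cA dA] := allP lA _ cdl.
  by rewrite (g_inj aA cA ac) (g_inj bA dA bd).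
have allE a : a \in A -> all (fun e => (g a != e.1) && (g a != e.2)) (map gg l) =
                      all (fun e => (a != e.1) && (a != e.2)) l.
  move=> aA; rewrite all_map; apply: eq_in_all => e el /=.
  by have /andP[cA dA] := allP lA _ el; rewrite !gE.
rewrite /link !memE // gE // !allE // -![(g _, g _) :: _]/(map gg ((_, _) :: _)).
case: ifP => _; first exact: IHes.
case: ifP => _; first by apply: IHes; rewrite //= yA xA.
by case: ifP => _ //; apply: IHes; rewrite //= yA xA.
Qed.

Lemma null_square_map (S : bool -> bool -> U) : (forall x y, S x y \in A) ->
  null_square (fun x y => g (S x y)) = null_square S.
Proof. by move=> SA; rewrite /null_square !(inj_in_eq g_inj). Qed.

Lemma null_cube_map (F : bool -> bool -> bool -> U) : (forall x y z, F x y z \in A) ->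
  null_cube (fun x y z => g (F x y z)) = null_cube F.
Proof. by move=> FA; rewrite /null_cube /=; rewrite !null_square_map //. Qed.

Lemma triangle_free_map es : onA es -> triangle_free (map gg es) = triangle_free es.
Proof.
move=> esA; have swapE : [seq (e.2, e.1) | e <- map gg es] =
  map gg [seq (e.2, e.1) | e <- es].
  by rewrite -!map_comp.
rewrite /triangle_free swapE -map_cat.
set es2 := _ ++ _; have {esA} es2A : onA es2.
  rewrite /onA all_cat all_map; apply/andP; split=> //.
  by apply/allP => e /(allP esA); rewrite /= andbC.
have gE : {in A &, forall a b, (g a == g b) = (a == b)} by exact: inj_in_eq.
rewrite filter_map !all_map.
have -> : [seq x <- es2 | preim gg (fun e => e.1 != e.2) x] =
          [seq e <- es2 | e.1 != e.2].
  by apply: eq_in_filter => e /(allP es2A)/andP[? ?] /=; rewrite gE.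
apply: eq_in_all => e; rewrite mem_filter => /andP[_ /(allP es2A)/andP[e1 e2]].
rewrite /= all_map; apply: eq_in_all => f /(allP es2A)/andP[f1 f2] /=.
rewrite gE //; case: ifP => // _; rewrite all_map.
by apply: eq_in_all => h /(allP es2A)/andP[h1 h2] /=; rewrite !gE.
Qed.
End GrowMap.

(* A map on [k] points is encoded, up to the names of its values, by sending each
   point to the first one with the same value, whence entries [nth i <= i]. *)
Fixpoint patterns (k : nat) : seq (seq nat) :=
  if k is k'.+1 then [seq rcons p i | p <- patterns k', i <- iota 0 k] else [:: [::]].

Lemma mem_patterns p :
  (forall i, (i < size p)%N -> (nth 0%N p i <= i)%N) -> p \in patterns (size p).
Proof.
elim/last_ind: p => [//|p x IHp] px; rewrite size_rcons.
apply/allpairsP; exists (p, x); split=> //.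
  apply: IHp => i ip; have := px i; rewrite size_rcons nth_rcons ip.
  by apply; apply: ltnW.
rewrite mem_iota add0n ltnS.
by have := px (size p); rewrite size_rcons nth_rcons ltnn eqxx; apply.
Qed.

Definition of_seq (T : Type) (x0 : T) (p : seq T) (x y z : bool) : T :=
  nth x0 p (x + 2 * y + 4 * z)%N.

(** The outer [if] spares the costlier tests for the patterns that fail [null_cube]. *)
Definition pattern_ok (p : seq nat) : bool :=
  let F := of_seq 0%N p in
  if null_cube F then triangle_free (image_edges F) ==> grow [::] (image_edges F)
  else true.

(** An exhaustive check of the [8! = 40320] patterns: null faces and absence of triangles always let
    the greedy search succeed. *)
Lemma patterns_ok : all pattern_ok (patterns 8).
Proof. by vm_compute. Qed.

Lemma pattern_okP p : size p = 8 ->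
  (forall i, (i < 8)%N -> (nth 0%N p i <= i)%N) -> pattern_ok p.
Proof.
move=> p8 pi; have := @mem_patterns p; rewrite p8 => /(_ pi).
by move: (patterns 8) patterns_ok => s /allP; apply.
Qed.

(** The corners are listed in the order read by [of_seq], the first coordinate varying fastest. *)
Definition values (V : Type) (F : bool -> bool -> bool -> V) : seq V :=
  [:: F false false false; F true false false; F false true false; F true true false;
      F false false true; F true false true; F false true true; F true true true].

(** Replacing each value by the index of its first occurrence turns [F] into one of the checked
    patterns. The forest found there is carried back by [g]. *)
Lemma null_cube_forest (V : eqType) (F : bool -> bool -> bool -> V) :
  null_cube F -> triangle_free (image_edges F) ->
  exists l, [/\ forest l, all (fun e => link l e.1 e.2) (image_edges F) &
    {in l, forall e, (e \in image_edges F) || ((e.2, e.1) \in image_edges F)}].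
Proof.
move=> F_null F_tri; set P := values F; set p := [seq index v P | v <- P].
pose x0 := F false false false; pose g i := nth x0 P i.
pose A : {pred nat} := mem p.
have g_index v : v \in P -> g (index v P) = v by exact: nth_index.
have g_inj : {in A &, injective g}.
  by move=> _ _ /mapP[v vP ->] /mapP[w wP ->]; rewrite !g_index // => ->.
pose L := of_seq 0%N p.
have LA x y z : L x y z \in A.
  by rewrite /L /of_seq; apply: mem_nth; rewrite size_map; case: x y z => [] [] [].
have gL x y z : g (L x y z) = F x y z.
  rewrite /L /of_seq (nth_map x0); last by case: x y z => [] [] [].
  rewrite g_index; first by case: x y z => [] [] [].
  by apply: mem_nth; case: x y z => [] [] [].
have FL : F = fun x y z => g (L x y z).
  by apply: funext => x; apply: funext => y; apply: funext => z; rewrite gL.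
have LA_edges : all (fun e => (e.1 \in A) && (e.2 \in A)) (image_edges L).
  by rewrite /= !LA.
have FE : image_edges F = [seq (g e.1, g e.2) | e <- image_edges L] by rewrite FL.
have : pattern_ok p.
  (* The first occurrence of the [i]-th value is at position [i] at the latest. *)
  apply: pattern_okP; rewrite ?size_map // => i iP; rewrite (nth_map x0) //.
  rewrite leqNgt; apply/negP => lt_i; have := before_find x0 lt_i.
  by rewrite /= eqxx.
rewrite /pattern_ok -/L.
have -> : null_cube L by rewrite -(null_cube_map g_inj) // -FL.
rewrite -(triangle_free_map g_inj LA_edges) -FE F_tri implyTb.
move: (image_edges L) (image_edges F) FE LA_edges {F_tri} => esL esF FE LA_edges;
  case growL: (grow _ _) => [l|] // _.
have /esym := grow_map g_inj (l := [::]) isT LA_edges; rewrite growL -FE => /esym.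
move=> /growP/(_ isT)[l_f esl _ sub]; exists [seq (g e.1, g e.2) | e <- l].
by split=> // e /sub.
Qed.

(** * Cubes of dimension at most 3 *)

Section LowDimension.
Variable G : graph.

Definition point0 : {ffun 'I_0 -> bool} := [ffun=> false].
Definition point1 x : {ffun 'I_1 -> bool} := insert ord0 x point0.
Definition point2 x y : {ffun 'I_2 -> bool} := insert ord0 x (point1 y).
Definition point3 x y z : {ffun 'I_3 -> bool} := insert ord0 x (point2 y z).

Lemma point1E (p : {ffun 'I_1 -> bool}) : p = point1 (head p).
Proof.
rewrite -{1}[p]insert_head_tail; congr (insert _ _ _).
by apply/ffunP => -[].
Qed.

Lemma point2E (p : {ffun 'I_2 -> bool}) : p = point2 (head p) (head (tail p)).
Proof. by rewrite -{1}[p]insert_head_tail {1}[tail p]point1E. Qed.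

Lemma point3E (p : {ffun 'I_3 -> bool}) :
  p = point3 (head p) (head (tail p)) (head (tail (tail p))).
Proof. by rewrite -{1}[p]insert_head_tail {1}[tail p]point2E. Qed.

Definition flat1 (x y : G) (p : {ffun 'I_1 -> bool}) : G := if head p then y else x.
Definition flat2 (S : bool -> bool -> G) (p : {ffun 'I_2 -> bool}) : G :=
  S (head p) (head (tail p)).
Definition flat3 (F : bool -> bool -> bool -> G) (p : {ffun 'I_3 -> bool}) : G :=
  F (head p) (head (tail p)) (head (tail (tail p))).

Definition edge x y := cube_class (flat1 x y).
Definition square S := cube_class (flat2 S).
Definition cube F := cube_class (flat3 F).

Definition along2 (R : rel G) (S : bool -> bool -> G) :=
  (forall b, R (S b false) (S b true)) /\ (forall b, R (S false b) (S true b)).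
Definition along3 (R : rel G) (F : bool -> bool -> bool -> G) :=
  (forall b, along2 R (F b)) /\ (forall b c, R (F false b c) (F true b c)).

Lemma along_flat1 (R : rel G) x y : symmetric R -> R x y -> along R (flat1 x y).
Proof.
move=> R_sym xy.
apply: (along_cons R_sym (F := fun b (_ : {ffun 'I_0 -> bool}) =>
  if b then y else x)) => //.
by move=> b; apply: along0.
Qed.

Lemma along_flat2 (R : rel G) S : symmetric R -> along2 R S -> along R (flat2 S).
Proof.
move=> R_sym [S1 S2].
apply: (along_cons R_sym (F := fun b q => S b (head q))) => [b|q]; last exact: S2.
apply: (along_cons R_sym (F := fun c (_ : {ffun 'I_0 -> bool}) => S b c)) => [c|q //].
exact: along0.
Qed.

Lemma along_flat3 (R : rel G) F : symmetric R -> along3 R F -> along R (flat3 F).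
Proof.
move=> R_sym [F1 F2].
apply: (along_cons R_sym (F := fun b q => F b (head q) (head (tail q)))) => [b|q //].
exact: along_flat2.
Qed.

Lemma edgexx x : edge x x = 0.
Proof. by apply: (cube_class_degenerate (i := ord0)) => q; rewrite /flat1 !if_same. Qed.

Lemma square_degenerate1 S : (forall b, S false b = S true b) -> square S = 0.
Proof.
move=> Sb; apply: (cube_class_degenerate (i := ord0)) => q.
by rewrite /flat2 !head_insert0 !tail_insert0.
Qed.

Lemma bd_square S : along2 (@near G) S -> bd (C G) 1 (square S) =
  (edge (S true false) (S true true) - edge (S false false) (S false true)) +
  (edge (S false false) (S true false) - edge (S false true) (S true true)).
Proof.
move=> SG; rewrite bd_cube_class; last exact/along_flat2/SG/near_sym.
rewrite !big_ord_recl big_ord0 addr0 /= expr1 mulrN1z opprB sqrrN expr1n mulr1z.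
have E0 b : cube_class (fun q =>
  flat2 S (insert ord0 b q)) = edge (S b false) (S b true).
  by apply: eq_cube_class => q; rewrite /flat2 head_insert0 tail_insert0 /flat1;
    case: (head q).
have E1 b : cube_class (fun q =>
  flat2 S (insert (lift ord0 ord0) b q)) = edge (S false b) (S true b).
  apply: eq_cube_class => q;
    rewrite /flat2 head_insertS tail_insertS head_insert0 /flat1.
  by case: (head q).
by rewrite !E0 !E1.
Qed.

Lemma bd_cube F : along3 (@near G) F -> bd (C G) 2 (cube F) =
  (square (F true) - square (F false)) +
  ((square (fun x => F x false) - square (fun x => F x true)) +
   (square (fun x y => F x y true) - square (fun x y => F x y false))).
Proof.
move=> FG; rewrite bd_cube_class; last exact/along_flat3/FG/near_sym.
rewrite !big_ord_recl big_ord0 addr0 /= expr1 mulrN1z opprB sqrrN expr1n mulr1z.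
rewrite [(-1) ^+ _]exprS sqrrN expr1n mulr1 mulrN1z opprB.
have E0 b : cube_class (fun q => flat3 F (insert ord0 b q)) = square (F b).
  by apply: eq_cube_class => q; rewrite /flat3 head_insert0 tail_insert0.
have E1 b : cube_class (fun q =>
  flat3 F (insert (lift ord0 ord0) b q)) = square (fun x => F x b).
  by apply: eq_cube_class => q;
    rewrite /flat3 head_insertS tail_insertS head_insert0 tail_insert0.
have E2 b : cube_class (fun q => flat3 F (insert (lift ord0 (lift ord0 ord0)) b q)) =
            square (fun x y => F x y b).
  apply: eq_cube_class => q.
  by rewrite /flat3 !(head_insertS, tail_insertS) head_insert0.
by rewrite !E0 !E1 !E2.
Qed.

Lemma cls2E (s : singular_cube G 2) : cls s = square (fun x y => s (point2 x y)).
Proof. by apply/esym/cube_class_cls => p; rewrite {2}[p]point2E. Qed.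

Lemma cube_adj_point2 : (forall b, cube_adj (point2 b false) (point2 b true)) /\
  (forall b, cube_adj (point2 false b) (point2 true b)).
Proof.
by split=> b; rewrite cube_adjS !head_insert0 !tail_insert0 ?eqxx //=
  cube_adjS !head_insert0 !tail_insert0 /= eqxx.
Qed.

Lemma along_point2 (R : rel G) s : along R s -> along2 R (fun x y => s (point2 x y)).
Proof. by have [a2 a1] := cube_adj_point2; move=> sR; split=> b; apply: sR. Qed.

Lemma cube_adj_point3 : [/\ forall b c, cube_adj (point3 b c false) (point3 b c true),
  forall b c, cube_adj (point3 b false c) (point3 b true c)
  & forall b c, cube_adj (point3 false b c) (point3 true b c)].
Proof.
have [a2 a1] := cube_adj_point2.
by split=> b c; rewrite cube_adjS !head_insert0 !tail_insert0 ?eqxx /=.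
Qed.

Lemma along_point3 (R : rel G) s : along R s -> along3 R (fun x y z =>
  s (point3 x y z)).
Proof.
have [a3 a2 a1] := cube_adj_point3.
by move=> sR; split=> [b|b c]; [split=> c|]; apply: sR.
Qed.

Lemma point2_inj : injective (fun b : bool * bool => point2 b.1 b.2).
Proof.
move=> [a b] [c d] /= E; have := congr1 (@head _) E; have := congr1 (@tail _) E.
by rewrite !head_insert0 !tail_insert0 => /(congr1 (@head _));
  rewrite !head_insert0 => -> ->.
Qed.
End LowDimension.

(** * Degree and injective subcubes *)

Section Degree.
Variable G : graph.

(** An injective face may have more than [k.+1] free coordinates. The first [k.+1] of them are kept
    free, the remaining ones are set to [false], and the fixed ones keep their values. *)
Lemma degree_ge k n (s : singular_cube G n) : (k < degree s)%N ->
  exists e : {ffun 'I_k.+1 -> bool} -> {ffun 'I_n -> bool},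
    (forall p q, cube_adj p q -> cube_adj (e p) (e q)) /\ injective (s \o e).
Proof.
move=> ks; have [a a_inj ka] : exists2 a, injective_face s a & (k < face_dim a)%N.
  case: (pselect (exists2 a, injective_face s a & (k < face_dim a)%N)) => // no.
  move: ks; rewrite ltnNge => /negP[]; apply/bigmax_leqP => a a_inj.
  by rewrite leqNgt; apply/negP => ka; apply: no; exists a.
pose A := [set i | a i == None].
have kA : (k.+1 <= #|A|)%N by [].
pose f (l : 'I_k.+1) : 'I_n := enum_val (widen_ord kA l : 'I_#|A|).
have f_inj : injective f.
  by move=> l m /enum_val_inj/(congr1 val)/= lm; apply: val_inj.
have fA l : a (f l) = None.
  by apply/eqP; have := enum_valP (widen_ord kA l); rewrite inE.
pose e (p : {ffun 'I_k.+1 -> bool}) : {ffun 'I_n -> bool} :=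
  [ffun i => if [pick l | f l == i] is Some l then p l else odflt false (a i)].
have ef p l : e p (f l) = p l.
  by rewrite ffunE; case: pickP => [m /eqP/f_inj-> //|/(_ l)]; rewrite eqxx.
have e_pts p : e p \in face_points a.
  rewrite inE; apply/forallP => i; rewrite ffunE; case: pickP => [l /eqP<-|_].
    by rewrite fA.
  by case: (a i).
exists e; split=> [p q|p q /(dinjectiveP _ _ a_inj) epq].
  rewrite /cube_adj => /eqP <-; rewrite -(card_imset _ f_inj); apply/eqP/eq_card => i.
  apply/idP/imsetP => [|[l + ->]]; last by rewrite !inE !ef.
  rewrite inE; rewrite !ffunE; case: pickP => [l /eqP<- pq|_]; last by rewrite eqxx.
  by exists l; rewrite // inE.
by apply/ffunP => l; rewrite -!ef epq.
Qed.

Lemma degree_injective n (s : singular_cube G n) : injective s -> (n <= degree s)%N.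
Proof.
move=> s_inj; pose a : {ffun 'I_n -> option bool} := [ffun=> None].
have {1}-> : n = face_dim a.
  by rewrite /face_dim -[LHS](card_ord n); apply/esym/eq_card => i; rewrite !inE ffunE.
apply: (leq_bigmax_cond (P := injective_face s)).
by apply/dinjectiveP => p q _ _ /s_inj.
Qed.

(** A cube of degree at least 2 would contain an injective square, which a forest excludes. *)
Lemma carried_forest_lt l n (x : C G n) : forest l ->
  x \in carried (link l) n -> x \in C_lt G 2 n.
Proof.
move=> l_f; apply: generated_sub => _ [s sl ->]; apply: cls_C_lt.
rewrite ltnNge; apply/negP => /degree_ge[e [e_adj e_inj]].
have [Sv Sh] : along2 (link l) (fun x y => s (e (point2 x y))).
  by apply: (along_point2 (s := s \o e)) => p q /e_adj/sl.
apply: (forest_no_square l_f (Sh false) (Sv true)).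
- by rewrite link_sym; apply: Sh.
- by rewrite link_sym; apply: Sv.
pose pt (b : bool * bool) := point2 b.1 b.2.
have se_inj : injective (s \o e \o pt) by apply: inj_comp => //; exact: point2_inj.
change (uniq (map (s \o e \o pt)
  [:: (false, false); (true, false); (false, true); (true, true)])).
by rewrite (map_inj_uniq se_inj).
Qed.
End Degree.

(** * Squares in bipartite graphs *)

Section Bipartite.
Variables (G : graph) (col : G -> bool).
Hypothesis colP : forall x y, adj x y -> col x != col y.

Lemma near_col x y : near x y -> x = y \/ col y = ~~ col x.
Proof.
case/orP=> [/colP xy|/eqP->]; [right|by left].
by move: xy; case: (col x); case: (col y).
Qed.

(** In a non-null square the diagonals are distinct. If a side collapsed, its opposite side would
    not, and the three remaining vertices would form a triangle, which two colours forbid. *)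
Lemma null_or_uniq S : along2 (@near G) S -> ~~ null_square S ->
  uniq [:: S false false; S true false; S false true; S true true].
Proof.
case=> S1 S2; rewrite !negb_or !negb_and => /and4P[nad nbc nabcd nacbd].
move: (S1 false) (S1 true) (S2 false) (S2 true) nad nbc nabcd nacbd.
set a := S false false; set b := S true false; set c := S false true;
  set d := S true true.
move=> ac bd ab cd nad nbc nabcd nacbd.
have tri (x y z : G) : near x y -> near y z -> near z x -> [|| x == y, y == z | z == x].
  move=> /near_col[->|xy]; first by rewrite eqxx.
  move=> /near_col[->|yz]; first by rewrite eqxx orbT.
  move=> /near_col[->|zx]; first by rewrite eqxx !orbT.
  by move: zx; rewrite yz xy !negbK; case: (col x).
have nab : a != b.
  apply/eqP => E; rewrite E eqxx /= in nabcd nad ac.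
  have := tri b c d ac cd;
    rewrite near_sym (negPf nbc) (negPf nabcd) /= eq_sym (negPf nad).
  by move=> /(_ bd).
have nac : a != c.
  apply/eqP => E; rewrite E eqxx /= in nacbd nad ab.
  have := tri c b d ab bd;
    rewrite near_sym eq_sym (negPf nbc) (negPf nacbd) /= eq_sym (negPf nad).
  by move=> /(_ cd).
have nbd : b != d.
  apply/eqP => E; rewrite -E in cd; rewrite near_sym in ab.
  by have := tri a c b ac cd ab;
    rewrite (negPf nac) eq_sym (negPf nbc) eq_sym (negPf nab).
have ncd : c != d.
  apply/eqP => E; rewrite -E in bd; rewrite near_sym in ac.
  by have := tri a b c ab bd ac; rewrite (negPf nab) (negPf nbc) eq_sym (negPf nac).
by rewrite /= !inE !negb_or nab nac nad nbc nbd ncd.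
Qed.
End Bipartite.

(** * Cubes of degree at most 1 in bipartite graphs *)

Lemma subrACA (V : zmodType) (a b c d : V) : a - b - (c - d) = a - c - (b - d).
Proof. by rewrite !opprD addrACA. Qed.

Section Vanishing.
Variables (G : graph) (col : G -> bool).
Hypothesis colP : forall x y, adj x y -> col x != col y.

Lemma degree_square (s : singular_cube G 2) :
  uniq [:: s (point2 false false); s (point2 true false);
           s (point2 false true); s (point2 true true)] -> (2 <= degree s)%N.
Proof.
move=> s_uniq; apply: degree_injective.
have inj4 : injective (fun b : bool * bool => s (point2 b.1 b.2)).
  move: s_uniq; rewrite /= !inE !negb_or.
  case/and4P=> /and3P[/eqP ab /eqP ac /eqP ad] /andP[/eqP bc /eqP bd] /eqP cd _.
  by move=> [[] []] [[] []] //= E; congruence.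
move=> p q; rewrite {1}[p]point2E {1}[q]point2E => /(inj4 (_, _) (_, _))[E1 E2].
by rewrite [p]point2E [q]point2E E1 E2.
Qed.

Lemma degree_null (s : singular_cube G 2) : (degree s < 2)%N ->
  null_square (fun x y => s (point2 x y)).
Proof.
rewrite ltnNge; apply: contraR => /(null_or_uniq colP (along_point2 (along_cube s))).
exact: degree_square.
Qed.

Lemma degree_null_cube (s : singular_cube G 3) : (degree s < 2)%N ->
  null_cube (fun x y z => s (point3 x y z)).
Proof.
move=> s2; have face_null i b : null_square (fun x y => face i b s (point2 x y)).
  exact/degree_null/(leq_ltn_trans (degree_face _ _ _) s2).
apply/allP => b _; apply/and3P; split.
- have := face_null ord0 b; congr null_square.
  by apply: funext => x; apply: funext => y; rewrite /= ffunE.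
- have := face_null (lift ord0 ord0) b; congr null_square.
  apply: funext => x; apply: funext => y; rewrite /= ffunE; congr (s _).
  rewrite [insert _ _ _]point3E !(head_insertS, tail_insertS) ?head_insert0
    ?tail_insert0.
  by rewrite !head_insert0 // tail_insert0 head_insert0.
- have := face_null (lift ord0 (lift ord0 ord0)) b; congr null_square.
  apply: funext => x; apply: funext => y; rewrite /= ffunE; congr (s _).
  rewrite [insert _ _ _]point3E !(head_insertS, tail_insertS) !head_insert0.
  by rewrite tail_insert0 head_insert0.
Qed.

(** Colours alternate along nontrivial edges, so three of them cannot close up. *)
Lemma triangle_free_edges F : along3 (@near G) F -> triangle_free (image_edges F).
Proof.
move=> [F1 F2]; have esG : all (fun e => near e.1 e.2) (image_edges F).
  by rewrite /image_edges /=; rewrite !(F1 _).1 !(F1 _).2 !F2.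
rewrite /triangle_free; move: (image_edges F) esG => es0 es0G.
set es := _ ++ _; have {es0G} esG : all (fun e => near e.1 e.2) es.
  rewrite all_cat es0G all_map; apply/allP => e /(allP es0G).
  by rewrite /= near_sym.
apply/allP => e; rewrite mem_filter => /andP[].
case: e => a b /= nab /(allP esG)/(near_col colP)/= ab;
  apply/allP => -[c d] /(allP esG)/(near_col colP)/= cd.
case: eqP => // bc; apply/allP => -[x y] /(allP esG)/(near_col colP)/= xy.
case: eqVneq => //= ncd; case: eqVneq => //= nxy.
case: (eqVneq d x) => //= dx; apply/eqP => ya; subst c x a.
case: ab => [/eqP|ab]; first by rewrite (negPf nab).
case: cd => [/eqP|cd]; first by rewrite (negPf ncd).
case: xy => [/eqP|xy]; first by rewrite (negPf nxy).
by move: ab; rewrite cd in xy; rewrite xy !negbK; case: (col b).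
Qed.

(* By the last clause, all edges of the forest come from [F]. *)
Lemma image_forest F : along3 (@near G) F -> null_cube F ->
  exists l, [/\ forest l, in_graph l, along3 (link l) F &
    forall R : rel G, reflexive R -> symmetric R -> along3 R F -> subrel (link l) R].
Proof.
move=> FG F_null.
have [l [l_f es_l sub]] := null_cube_forest F_null (triangle_free_edges FG).
have sub_R (R : rel G) : symmetric R -> along3 R F -> {in l, forall e, R e.1 e.2}.
  move=> R_sym [R1 R2] e /sub.
  have esR : all (fun e => R e.1 e.2) (image_edges F).
    by rewrite /image_edges /= !(R1 _).1 !(R1 _).2 !R2.
  by case/orP=> /(allP esR) //=; rewrite R_sym.
have l_neq : {in l, forall e, e.1 != e.2}.
  elim: (l) l_f => //= -[w v] m IHm /and3P[wv _ /IHm IH] e.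
  by rewrite inE => /orP[/eqP->|/IH].
exists l; split=> //.
- apply/allP => e el; have := sub_R _ (@near_sym G) FG e el.
  by rewrite /near (negPf (l_neq e el)) orbF.
- have lE u v : (u, v) \in image_edges F -> link l u v by exact: (allP es_l).
  split=> [b|b c]; [split=> c|]; apply: lE; case: b; case: c;
    by rewrite /image_edges /= !inE eqxx ?orbT.
- move=> R R_refl R_sym FR x y; rewrite /link => /or3P[/eqP->|xy|yx];
  first exact: R_refl.
    exact: (sub_R R R_sym FR _ xy).
  by rewrite R_sym; apply: (sub_R R R_sym FR _ yx).
Qed.

(** A square filling the closed walk from [x] to [y] and back: modulo boundaries it makes the two
    orientations of an edge opposite. *)
Definition back (x y : G) : C G 2 := square (fun t u => if u && ~~ t then y else x).

Lemma backxx x : back x x = 0.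
Proof. by apply: square_degenerate1 => b; rewrite !if_same. Qed.

Lemma bd_back x y : near x y -> bd (C G) 1 (back x y) = - (edge x y + edge y x).
Proof.
move=> xy; have yx : near y x by rewrite near_sym.
rewrite bd_square; last first.
  by split=> -[] //=; rewrite /near eqxx orbT.
by rewrite /= !edgexx !sub0r opprD.
Qed.

(* Orienting the edges from [col = false] to [col = true], [fill1] pairs every
   edge of the wrong orientation with its reverse. *)
Definition fill1 : C G 1 -> C G 2 := lin (fun s : singular_cube G 1 =>
  let x := s (point1 false) in let y := s (point1 true) in
  if col x then - back x y else 0).

HB.instance Definition _ :=
  GRing.isZmodMorphism.Build (C G 1) (C G 2) fill1 (lin_zmod_morphism _).

Lemma fill1B x y : fill1 (x - y) = fill1 x - fill1 y.
Proof. exact: raddfB. Qed.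

Lemma fill1D x y : fill1 (x + y) = fill1 x + fill1 y.
Proof. exact: raddfD. Qed.

Lemma fill1_edge x y : near x y -> fill1 (edge x y) = if col x then - back x y else 0.
Proof.
move=> xy; have [s sE sC] := cube_classP (along_flat1 (@near_sym G) xy).
rewrite /edge sC [LHS]lin_cls -!sE /flat1 !head_insert0.
case: ifP => // /existsP[i /eqP].
rewrite (ord1 i) => /(congr1 (fun t : singular_cube G 0 => t point0)).
rewrite /= !ffunE -![s _]sE /flat1 !head_insert0 => <-.
by rewrite backxx oppr0 if_same.
Qed.

(** The normal form of an edge once the boundary of its [fill1] is removed; by bipartiteness it is
    antisymmetric in its ends. *)
Definition oriented (x y : G) : C G 1 := if col x then - edge y x else edge x y.

Lemma orientedN x y : near x y -> oriented y x = - oriented x y.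
Proof.
case/(near_col colP)=> [->|xy]; rewrite /oriented;
  first by rewrite edgexx oppr0 if_same oppr0.
by rewrite xy; case: (col x); rewrite /= ?opprK.
Qed.

Lemma oriented_edge x y : near x y ->
  edge x y - bd (C G) 1 (fill1 (edge x y)) = oriented x y.
Proof.
move=> xy; rewrite fill1_edge // /oriented; case: (col x); last by rewrite bd0 subr0.
rewrite -[- back _ _]sub0r bdB bd0 sub0r opprK bd_back //.
by rewrite opprD addrA subrr sub0r.
Qed.

(** After the correction the boundary is the sum of the [oriented] sides along the boundary walk,
    and these cancel in pairs or vanish in each of the four null shapes. *)
Lemma fill1_square_cycle S : along2 (@near G) S -> null_square S ->
  bd (C G) 1 (square S - fill1 (bd (C G) 1 (square S))) = 0.
Proof.
move=> SG S_null; rewrite bdB bd_square //; case: (SG) => S1 S2.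
have bdD x y : bd (C G) 1 (x + y) = bd (C G) 1 x + bd (C G) 1 y by exact: raddfD.
rewrite fill1D !fill1B bdD !bdB.
have E (a b c d a' b' c' d' : C G 1) :
    a - b + (c - d) - (a' - b' + (c' - d')) =
      (a - a') - (b - b') + ((c - c') - (d - d')).
  by rewrite opprD addrACA; congr (_ + _); rewrite !opprD addrACA.
rewrite E !oriented_edge //.
case/or4P: S_null => [/eqP E1|/eqP E1|/andP[/eqP E1 /eqP E2]|/andP[/eqP E1 /eqP E2]].
- have A := orientedN (S2 false); have B := orientedN (S1 false).
  by rewrite -E1 A B opprK -opprD addNr.
- by rewrite -E1 addrA subrK subrr.
- by rewrite -E1 -E2 subrr add0r /oriented !edgexx oppr0 !if_same subrr.
- by rewrite -E1 -E2 subrr addr0 /oriented !edgexx oppr0 !if_same subrr.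
Qed.

(* The last clause allows the fillings of the faces of a 3-cube to be pushed into
   one common forest. *)
Lemma filling2 (s : singular_cube G 2) : (degree s < 2)%N ->
  exists y, [/\ bd (C G) 2 y = cls s - fill1 (bd (C G) 1 (cls s)), y \in C_lt G 2 3 &
    forall l, along (link l) s -> y \in carried (link l) 3].
Proof.
move=> /degree_null; set S := (fun x y => s _) => S_null; rewrite cls2E -/S.
have SG : along2 (@near G) S by apply/along_point2/along_cube.
(* The square is viewed as a cube constant in its third direction, in order to use the forest of a
   3-cube. *)
have FG : along3 (@near G) (fun x y _ => S x y).
  by case: (SG) => S1 S2; split=> [b|//]; split=> [c|//]; rewrite /near eqxx orbT.
have F_null : null_cube (fun x y (_ : bool) => S x y).
  by apply/allP => b _; rewrite /null_square !eqxx ?orbT.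
have [l [l_f lG [l1 l2] lR]] := image_forest FG F_null.
have Sl : along2 (link l) S by split=> b; [apply: (l1 b).2|apply: l2 b false].
have cl : square S - fill1 (bd (C G) 1 (square S)) \in carried (link l) 2.
  have eC x y : near x y -> link l x y -> fill1 (edge x y) \in carried (link l) 2.
    move=> xy lxy; rewrite fill1_edge //; case: (col x); last exact: rpred0.
    rewrite rpredN; apply/carried_cube_class/along_flat2; first exact: link_sym.
    have lyx : link l y x by rewrite link_sym.
    by split=> -[] //=; rewrite linkxx.
  apply: rpredB; first exact/carried_cube_class/along_flat2/Sl/link_sym.
  case: (SG) (Sl) => [G1 G2] [S1 S2].
  rewrite bd_square // fill1D !fill1B.
  by apply: rpredD; apply: rpredB; apply: eC.
have [y yl dy] := forest_acyclic l_f lG cl (fill1_square_cycle SG S_null).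
exists y; split=> // [|m sm]; first exact: carried_forest_lt l_f yl.
(* The forest [l] consists of edges of [S] only, so its links hold in any forest along which [s]
   runs. *)
apply: sub_carried yl; apply: lR.
- exact: linkxx.
- exact: link_sym.
- have [m1 m2] := along_point2 sm.
  split=> [b|b c]; last exact: m2.
  by split=> [c|c]; [apply: linkxx|apply: m1].
Qed.

(** One filling per cube is chosen by [cid]; cubes of degree at least 2 get the default [0], so that
    [fill2] is total and additive. *)
Definition fill2_cube (s : singular_cube G 2) : C G 3 :=
  if pselect ((degree s < 2)%N) is left s2 then sval (cid (filling2 s2)) else 0.

Definition fill2 : C G 2 -> C G 3 := lin fill2_cube.

HB.instance Definition _ :=
  GRing.isZmodMorphism.Build (C G 2) (C G 3) fill2 (lin_zmod_morphism _).

Lemma fill2B x y : fill2 (x - y) = fill2 x - fill2 y.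
Proof. exact: raddfB. Qed.

Lemma fill20 : fill2 0 = 0.
Proof. exact: raddf0. Qed.

Lemma fill10 : fill1 0 = 0.
Proof. exact: raddf0. Qed.

Lemma fill2_carried (s : singular_cube G 2) l : (degree s < 2)%N ->
  along (link l) s -> fill2 (cls s) \in carried (link l) 3.
Proof.
move=> s2 sl; rewrite [fill2 _]lin_cls; case: ifP => _; first exact: rpred0.
rewrite /fill2_cube; case: pselect => // {}s2.
by case: (cid _) => y /= [_ _]; apply.
Qed.

Lemma bd_fill2_cls (s : singular_cube G 2) : (degree s < 2)%N ->
  bd (C G) 2 (fill2 (cls s)) = cls s - fill1 (bd (C G) 1 (cls s)).
Proof.
move=> s2; rewrite [fill2 _]lin_cls; case: ifP => [/cls_degenerate->|_].
  by rewrite !bd0 fill10 subrr.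
by rewrite /fill2_cube; case: pselect => // {}s2; case: (cid _) => y /= [].
Qed.

Lemma fill2_lt x : x \in C_lt G 2 2 -> fill2 x \in C_lt G 2 3.
Proof.
apply: generated_map => _ [s /andP[/negPf s_nd s2] ->].
change (fill2 (cls s) \in C_lt G 2 3).
rewrite [fill2 _]lin_cls s_nd /fill2_cube; case: pselect => // {}s2.
by case: (cid _) => y /= [].
Qed.

(** On chains of degree at most 1, [fill1] and [fill2] are a partial contracting homotopy,
    constructed cube by cube. *)
Lemma bd_fill2 x : x \in C_lt G 2 2 ->
  bd (C G) 2 (fill2 x) = x - fill1 (bd (C G) 1 x).
Proof.
apply: (generated_ind (P := fun x => bd (C G) 2 (fill2 x) = x - fill1 (bd (C G) 1 x))).
- by rewrite fill20 !bd0 fill10 subrr.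
- by move=> y z yE zE; rewrite fill2B !bdB fill1B yE zE subrACA.
by move=> _ [s /andP[_ s2] ->]; apply: bd_fill2_cls.
Qed.

Lemma degree1_exact2 x : x \in C_lt G 2 2 -> bd (C G) 1 x = 0 ->
  exists2 y, y \in C_lt G 2 3 & bd (C G) 2 y = x.
Proof.
by move=> x2 dx; exists (fill2 x); rewrite ?fill2_lt // bd_fill2 // dx fill10 subr0.
Qed.

(** The next stage of acyclic carriers: for each cube, [cls s - fill2 (bd (cls s))] is a cycle
    carried by the forest of [s], hence a boundary. By additivity the same holds for [x], whose
    correction term vanishes. *)
Lemma degree1_exact3 x : x \in C_lt G 2 3 -> bd (C G) 2 x = 0 ->
  exists y, bd (C G) 3 y = x.
Proof.
move=> x3 dx; suff [y dy] : exists y, bd (C G) 3 y = x - fill2 (bd (C G) 2 x).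
  by exists y; rewrite dy dx fill20 subr0.
apply: (generated_ind (P := fun x =>
  exists y, bd (C G) 3 y = x - fill2 (bd (C G) 2 x))) x3 => {x dx}.
- by exists 0; rewrite !bd0 fill20 subrr.
- by move=> x z [y yE] [t tE]; exists (y - t); rewrite !bdB fill2B yE tE subrACA.
move=> _ [s /andP[_ s2] ->].
have [l [l_f lG Fl _]] :=
  image_forest (along_point3 (along_cube s)) (degree_null_cube s2).
have sl : along (link l) s.
  have := along_flat3 (@link_sym _ l) Fl; congr along; apply: funext => p.
  by rewrite /flat3 -point3E.
have d2 : bd (C G) 2 (cls s) \in C_lt G 2 2 by apply/part_bd/cls_C_lt.
(* All faces of [s] run along the same forest, so their fillings are carried by it as well. *)
have cl : cls s - fill2 (bd (C G) 2 (cls s)) \in carried (link l) 3.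
  apply: rpredB; first exact: carried_cls.
  rewrite bd_cls (raddf_sum fill2); apply: rpred_sum => i _.
  rewrite (raddfMz fill2); apply: rpredMz; rewrite /= fill2B.
  apply: rpredB; (apply: fill2_carried;
    first exact: leq_ltn_trans (degree_face _ _ _) s2);
    by move=> p q pq; rewrite /= !ffunE; apply/sl/cube_adj_insert.
have dz : bd (C G) 2 (cls s - fill2 (bd (C G) 2 (cls s))) = 0.
  by rewrite bdB bd_fill2 // bdK fill10 subr0 subrr.
by have [y _ dy] := forest_acyclic l_f lG cl dz; exists y.
Qed.
End Vanishing.

(** * Comparison of [H 3] with the homology of the degree 2 quotient *)

Section ThirdHomology.
Variables (G : graph) (col : G -> bool).
Hypothesis colP : forall x y, adj x y -> col x != col y.
Hypothesis degree_lt3 : forall n (s : singular_cube G n), (degree s < 3)%N.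

Local Open Scope quotient_scope.

Lemma C_lt_full n (x : C G n) : x \in C_lt G 3 n.
Proof.
apply: (chain_ind (P := fun x => x \in C_lt G 3 n)) => [|y z|s _].
- exact: rpred0.
- exact: rpredB.
- exact: cls_C_lt.
Qed.

Let B : subcomplex (sub_complex (C_lt G 3)) := restrict (C_lt G 3) (C_lt G 2).
Let proj n : sub_complex (C_lt G 3) n -> C_deg G 2 n := \pi_(Quotient.quot (B n)).
Let incl n (x : C G n) : sub_complex (C_lt G 3) n := Sub x (C_lt_full x).

Let projB n x y : @proj n (x - y) = proj x - proj y.
Proof. exact: raddfB. Qed.

Let proj_eq0 n (x : sub_complex (C_lt G 3) n) : proj x = 0 <-> val x \in C_lt G 2 n.
Proof. by split=> [/eqP|x2]; [|apply/eqP]; rewrite pi_eq0. Qed.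

Let bd_proj n x : bd (C_deg G 2) n (proj x) = proj (sub_bd x).
Proof. exact: quot_bd_pi. Qed.

Let inclB n (x y : C G n) : incl (x - y) = incl x - incl y.
Proof. exact: val_inj. Qed.

Let proj_incl_cycle n (x : subgroup (@cycles (C G) n.+1)) :
  proj (incl (val x)) \in @cycles (C_deg G 2) n.+1.
Proof.
have := valP x; rewrite !unfold_in /= => /eqP dx.
rewrite [quot_bd _]bd_proj; apply/eqP/proj_eq0; rewrite /= dx; exact: rpred0.
Qed.

Let to_deg (x : subgroup (@cycles (C G) 3)) : H_deg 2 3 G :=
  \pi_(Quotient.quot (preim_group
    (\val : subgroup (@cycles (C_deg G 2) 3) -> C_deg G 2 3)
    (@boundaries (C_deg G 2) 3)))
  (Sub (proj (incl (val x))) (proj_incl_cycle x)).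

Fact to_deg_zmod_morphism : zmod_morphism to_deg.
Proof.
move=> x y; rewrite /to_deg -raddfB; congr (\pi_ _ _); apply: val_inj => /=.
by rewrite -projB -inclB.
Qed.

HB.instance Definition _ :=
  GRing.isZmodMorphism.Build (subgroup (@cycles (C G) 3)) (H_deg 2 3 G) to_deg
    to_deg_zmod_morphism.

(** A part of the long exact sequence of the pair formed by [C] and its subcomplex [C_lt G 2]; the
    whole of [C] is [C_lt G 3]. *)
Lemma third_homology : isomorphic (H 3 G) (H_deg 2 3 G).
Proof.
apply: (@isomorphic_subquotient _ _ _ _ to_deg) => [x|w].
  have -> : (to_deg x = 0) <-> (proj (incl (val x)) \in @boundaries (C_deg G 2) 3).
    by split=> [/eqP|x0]; [|apply/eqP]; rewrite pi_eq0.
  split=> [/asboolP[y]|/asboolP[y xy]]; last first.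
    apply/asboolP; exists (proj (incl y)); rewrite bd_proj; congr (proj _).
    by apply: val_inj.
  (* Injectivity: [x] and the boundary of [z] differ by a cycle of degree at most 1, which bounds by
     [degree1_exact3]. *)
  rewrite -[y]reprK -[\pi_ _ _]/(proj (repr y)) bd_proj; move: (repr y) => z.
  move=> /eqP; rewrite -subr_eq0 -projB => /eqP/proj_eq0 /= xz.
  have dx : bd (C G) 2 (val x) = 0 by apply/eqP; exact: (valP x).
  have [|t tE] := degree1_exact3 colP xz; first by rewrite bdB dx bdK subrr.
  apply/asboolP; exists (t + val z).
  by rewrite (raddfD (bd (C G) 3)) /= tE subrK.
(* Surjectivity: a relative cycle lifts to [z], whose boundary is a cycle of degree at most 1.
   Filling it by some [y] of degree at most 1 gives an absolute cycle [z - y] with the same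
   class. *)
rewrite -[w]reprK; move: (repr w) => q.
have [z zE] : exists z, proj z = val q by exists (repr (val q)); exact: reprK.
have dz : bd (C G) 2 (val z) \in C_lt G 2 2.
  have /proj_eq0 : proj (sub_bd z) = 0 by rewrite -bd_proj zE; apply/eqP;
    exact: (valP q).
  by [].
have ddz : bd (C G) 1 (bd (C G) 2 (val z)) = 0 by exact: bdK.
have [y y2 dy] := degree1_exact2 colP dz ddz.
have xC : val z - y \in @cycles (C G) 3.
  by rewrite unfold_in; apply/eqP; rewrite bdB dy subrr.
exists (Sub (val z - y) xC); congr (\pi_ _ _); apply: val_inj => /=.
apply/eqP; rewrite -zE -subr_eq0 -projB; apply/eqP/proj_eq0 => /=.
by rewrite addrAC subrr sub0r rpredN.
Qed.
End ThirdHomology.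

(** * Greene spheres *)

Section Greene.
Variable n : nat.
Hypothesis n_ge4 : (4 <= n)%N.
Let G := greene_sphere n.
Implicit Types (i j k : 'I_(2 * n)) (x y : G).

Let next j : 'I_(2 * n) := ordS j.
Let prev j : 'I_(2 * n) := ord_pred j.
Let cyc j : G := inl j.
Let hub (b : bool) : G := inr b.

Lemma nextK : cancel next prev. Proof. exact: ordSK. Qed.
Lemma prevK : cancel prev next. Proof. exact: ord_predK. Qed.

Lemma odd_next j : odd (next j) = ~~ odd j.
Proof. by rewrite /next /= odd_mod ?mul2n ?odd_double. Qed.

Lemma odd_prev j : odd (prev j) = ~~ odd j.
Proof. by rewrite -{2}[j]prevK odd_next negbK. Qed.

Lemma val_iter_next m j : val (iter m next j) = ((j + m) %% (2 * n))%N.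
Proof.
elim: m => [|m IHm]; first by rewrite addn0 /= modn_small.
by rewrite iterS /= IHm -addn1 modnDml addn1 addnS.
Qed.

(** Here [4 <= n] enters: the cycle has at least eight vertices. *)
Lemma iter_next m j : (0 < m < 8)%N -> iter m next j != j.
Proof.
move=> m8; apply/eqP => /(congr1 val); rewrite val_iter_next.
rewrite -[RHS](modn_small (ltn_ord j)) => /eqP;
  rewrite -[X in _ == X %[mod _]]addn0 eqn_modDl mod0n modn_small; lia.
Qed.

Lemma iter_next_surj j k : exists m, iter m next j = k.
Proof.
(* The number of steps is [k - j] modulo [2 * n], written so that no subtraction is truncated. *)
exists (k + (2 * n - j))%N; apply: val_inj; rewrite val_iter_next.
have -> : (j + (k + (2 * n - j)) = k + 2 * n)%N by have := ltn_ord j; lia.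
by rewrite modnDr modn_small.
Qed.

Lemma next_prev_neq j : [/\ next j != j, prev j != j, next j != prev j,
  prev j != next (next j) & [/\ prev (prev j) != next j, prev (prev j) != next (next j)
    & prev j != next (next (next j))]].
Proof.
have E m k l : (0 < m < 8)%N -> iter m next k = l -> k != l.
  by move=> m8 <-; rewrite eq_sym iter_next.
split; last split; rewrite 1?eq_sym.
- exact: (E 1).
- by rewrite eq_sym; apply: (E 1); rewrite //= prevK.
- by rewrite (E 2) //= prevK.
- by rewrite eq_sym; apply: (E 3); rewrite //= prevK.
- by rewrite eq_sym; apply: (E 3); rewrite //= !prevK.
- by rewrite eq_sym; apply: (E 4); rewrite //= !prevK.
- by rewrite eq_sym; apply: (E 4); rewrite //= !prevK.
Qed.

Lemma adj_cyc j x : adj (cyc j) x =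
  [|| x == cyc (next j), x == cyc (prev j) | x == hub (odd j)].
Proof.
case: x => [k|b]; last by rewrite /= eq_sym.
rewrite /= orbF; apply/orP/orP => -[/eqP E|/eqP E].
- by left; apply/eqP; congr inl; apply: val_inj; rewrite /= E.
- right; apply/eqP; congr inl; rewrite -[k]nextK; congr prev.
  by apply: val_inj; rewrite /= -E.
- by left; case: E => ->.
- by right; case: E => ->; rewrite -{1}[j]prevK.
Qed.

Definition colour x : bool := match x with inl j => odd j | inr b => ~~ b end.

Lemma colourP x y : adj x y -> colour x != colour y.
Proof.
case: x y => [j|b] [k|c] //=; last by move=> /eqP->; case: b.
  by case/orP=> /eqP->; rewrite odd_mod ?mul2n ?odd_double //=; case: (odd _).
by move=> /eqP->; case: c.
Qed.

(** The other vertices near [prev j] are [prev j] itself and [prev (prev j)], and both are too far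
    from [next j] on so long a cycle. *)
Lemma common_neighbour j x : near (cyc (prev j)) x -> near (cyc (next j)) x ->
  x = cyc j \/ x = hub (~~ odd j).
Proof.
have [nj pj npj pnn [ppn ppnn pnnn]] := next_prev_neq j.
rewrite /near !adj_cyc prevK nextK odd_next odd_prev.
case: (eqVneq x (cyc j)) => [|_]; first by left.
case: (eqVneq x (hub _)) => [|_]; first by right.
rewrite /= !orbF ![_ == x]eq_sym; case/orP=> /eqP->; rewrite /cyc !(inj_eq inl_inj).
  by rewrite (negPf ppnn) (negPf ppn).
by rewrite (negPf pnn) [prev j == _]eq_sym (negPf npj).
Qed.

(* The cycle and one hub have [2 n + 1 > 8] vertices. *)
Lemma card_image (t : {ffun 'I_3 -> bool} -> G) b :
  (forall j, exists p, t p = cyc j) -> (exists p, t p = hub b) -> False.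
Proof.
move=> t_cyc t_hub; pose f (o : option 'I_(2 * n)) : G := if o is Some j then cyc j
  else hub b.
have f_inj : injective f by move=> [j|] [k|] //= [->].
have : (#|{: option 'I_(2 * n)}| <= #|codom t|)%N.
  rewrite -(card_codom f_inj); apply/subset_leq_card/subsetP => _ /codomP[[j|] ->].
    by rewrite /f; have [p <-] := t_cyc j; apply: codom_f.
  by rewrite /f; have [p <-] := t_hub; apply: codom_f.
move=> /leq_trans/(_ (leq_image_card _ _)).
rewrite card_option card_ord card_ffun card_bool card_ord; lia.
Qed.

(** A corner of an injective 3-cube has three distinct neighbours, and a cycle vertex has only
    three. Once one cycle vertex is in the image, so are all its neighbours, and by iteration the
    whole cycle and a hub, against [card_image]. *)
Lemma greene_degree_lt3 m (s : singular_cube G m) : (degree s < 3)%N.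
Proof.
rewrite ltnNge; apply/negP => /degree_ge[e [e_adj t_inj]]; set t := s \o e in t_inj.
pose flip (d : 'I_3) (p : {ffun 'I_3 -> bool}) : {ffun 'I_3 -> bool} := [ffun l =>
  (l == d) (+) p l].
have cube_flip d p : cube_adj p (flip d p).
  rewrite /cube_adj; apply/eqP; rewrite -[RHS](cards1 d); apply: eq_card => l.
  by rewrite !inE ffunE; case: (l == d); case: (p l).
have flip_inj p : injective (flip^~ p).
  move=> d d' /ffunP/(_ d); rewrite !ffunE eqxx; case: eqP => //.
  by case: (p d).
have adj_t d p : adj (t p) (t (flip d p)).
  have := along_cube s (e_adj _ _ (cube_flip d p)); rewrite /near; case/orP=> // /eqP E.
  have /ffunP/(_ d) := t_inj p (flip d p) E.
  by rewrite ffunE eqxx; case: (p d).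
have neighbours p j : t p = cyc j -> forall x, adj (cyc j) x -> exists q, t q = x.
  move=> tp x; rewrite adj_cyc => jx.
  pose A : {set G} := [set cyc (next j); cyc (prev j); hub (odd j)].
  have : x \in [set t (flip d p) | d in [set: 'I_3]].
    (* The three distinct images lie in [A], which has at most three elements, so they exhaust
       it. *)
    have -> : [set t (flip d p) | d in [set: 'I_3]] = A; last by rewrite !inE -orbA.
    apply/eqP; rewrite eqEcard; apply/andP; split.
      by apply/subsetP => _ /imsetP[d _ ->]; rewrite !inE -orbA -adj_cyc -tp.
    rewrite card_imset ?cardsT ?card_ord; last by move=> d d' /t_inj/flip_inj.
    rewrite /A; apply: leq_trans (leq_card_setU _ _) _; rewrite cards1 addn1 ltnS.
    by rewrite cards2; case: eqP.
  by case/imsetP=> d _ ->; exists (flip d p).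
(* The hubs are not adjacent, so one of two adjacent corners maps to the cycle. *)
have [p [j tp]] : exists p j, t p = cyc j.
  case tp : (t [ffun=> false]) => [j|b]; first by exists [ffun=> false], j.
  have := adj_t ord0 [ffun=> false]; rewrite tp; case tq : (t _) => [j|c] // _.
  by exists (flip ord0 [ffun=> false]), j.
apply: (@card_image t (odd j)) => [k|].
  have [m' <-] := iter_next_surj j k; elim: m' => [|m' [q tq]]; first by exists p.
  by apply: (neighbours q _ tq); rewrite adj_cyc eqxx.
by apply: (neighbours p j tp); rewrite adj_cyc eqxx !orbT.
Qed.

(** * Winding numbers of squares around the cycle vertices *)

Definition turn j (p q r : G) : int :=
  [&& p == cyc (prev j), q == cyc j & r == cyc (next j)]%:Z -
  [&& p == cyc (next j), q == cyc j & r == cyc (prev j)]%:Z.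

(* The signed number of passages of the boundary walk of [S] through [j], that
   is, the degree of [S] over the face of the sphere around [j]. *)
Definition wind j (S : bool -> bool -> G) : int :=
  turn j (S false true) (S false false) (S true false) +
  turn j (S false false) (S true false) (S true true) +
  turn j (S true false) (S true true) (S false true) +
  turn j (S true true) (S false true) (S false false).

(** The signed traversal of the cycle edge from [j] to [next j], the edge shared by the faces around
    these two vertices. *)
Definition pass j (p q : G) : int :=
  ((p == cyc j) && (q == cyc (next j)))%:Z - ((p == cyc (next j)) && (q == cyc j))%:Z.

Lemma turnC j p q r : turn j r q p = - turn j p q r.
Proof.
rewrite /turn; move: (p == cyc (next j)) (p == cyc (prev j)) (r == cyc (next j)).
by move: (r == cyc (prev j)) (q == cyc j) => [] [] [] [] [].
Qed.

Lemma turn_back j p q : turn j p q p = 0.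
Proof. by have := turnC j p q p; move: (turn _ _ _ _) => z; lia. Qed.

Lemma turn_stay j p q : turn j p q q = 0.
Proof.
have [nj pj _ _ _] := next_prev_neq j.
rewrite /turn; case: (eqVneq q (cyc j)) => [->|]; last by rewrite !andbF.
by rewrite /cyc !(inj_eq inl_inj) ![j == _]eq_sym (negPf nj) (negPf pj) !andbF.
Qed.

Lemma passC j p q : pass j q p = - pass j p q.
Proof. by rewrite /pass opprB; congr (_%:Z - _%:Z); rewrite andbC. Qed.

Lemma passxx j p : pass j p p = 0.
Proof. by have := passC j p p; move: (pass _ _ _) => z; lia. Qed.

Lemma turn_stayl j p q : turn j p p q = 0.
Proof. by rewrite turnC turn_stay oppr0. Qed.

(** The boundary walk backtracks or stays put: each [turn] vanishes or is met a second time
    reversed. *)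
Lemma wind_null j S : null_square S -> wind j S = 0.
Proof.
rewrite /wind; case/or4P=> [/eqP E|/eqP E|/andP[/eqP E /eqP F]|/andP[/eqP E /eqP F]].
- by rewrite -E !turn_back !addr0 turnC addNr.
- by rewrite -E !turn_back !add0r addr0 turnC addNr.
- by rewrite -E -F !turn_stay !turn_stayl.
- by rewrite -E -F !turn_stay !turn_stayl.
Qed.

(** A nonzero [turn] puts [j] at a corner, between [prev j] and [next j]. The opposite corner is
    another common neighbour of these two, hence a hub. *)
Lemma wind_support j S : along2 (@near G) S -> wind j S != 0 ->
  (exists b c, S b c = cyc j) /\ (exists b c d, S b c = hub d).
Proof.
move=> SG wS; have S_null : ~~ null_square S.
  by apply: contra wS => /(wind_null j)->.
have := null_or_uniq colourP SG S_null; case: (SG) => S1 S2.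
have turnE p q r : turn j p q r != 0 -> q = cyc j /\
    (p = cyc (prev j) /\ r = cyc (next j) \/ p = cyc (next j) /\ r = cyc (prev j)).
  rewrite /turn; have [/and3P[/eqP-> /eqP-> /eqP->]|_] := boolP (_ && _).
    by move=> _; split; [|left].
  by have [/and3P[/eqP-> /eqP-> /eqP->]|//] := boolP (_ && _); split; [|right].
have opposite p q r o : near p o -> near r o -> o != q -> turn j p q r != 0 ->
    q = cyc j /\ exists d, o = hub d.
  move=> po ro oq /turnE[qj pr]; split=> //; exists (~~ odd j).
  have : near (cyc (prev j)) o /\ near (cyc (next j)) o.
    by case: pr => -[<- <-].
  case=> h1 h2; case: (common_neighbour h1 h2) => [oj|//].
  by rewrite oj qj eqxx in oq.
rewrite /= !inE !negb_or => /and4P[/and3P[ab ac ad] /andP[bc bd] cd _].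
have N b c b' c' : near (S b c) (S b' c') -> near (S b' c') (S b c) by rewrite near_sym.
move: wS; rewrite /wind => wS.
suff [b [c [d]]] : exists b c d, S b c = cyc j /\ exists b c, S b c = hub d.
  by case=> E F; split; [exists b, c|case: F => b' [c' F]; exists b', c', d].
have [E|/opposite H] := eqVneq (turn j (S false true) (S false false) (S true false))
  0; last first.
  have [||//|qj [d dE]] := H (S true true); rewrite ?(eq_sym (S true true)) //.
  by exists false, false, d; split=> //; exists true, true.
have [F|/opposite H] := eqVneq (turn j (S false false) (S true false) (S true true))
  0; last first.
  have [|||qj [d dE]] := H (S false true); rewrite // 1?near_sym // 1?eq_sym //.
  by exists true, false, d; split=> //; exists false, true.
have [K|/opposite H] := eqVneq (turn j (S true false) (S true true) (S false true)) 0;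
  last first.
  have [|||qj [d dE]] := H (S false false); rewrite // 1?near_sym //.
  by exists true, true, d; split=> //; exists false, false.
have [L|/opposite H] := eqVneq (turn j (S true true) (S false true) (S false false))
  0; last first.
  have [|||qj [d dE]] := H (S true false); rewrite // 1?near_sym //.
  by exists false, true, d; split=> //; exists true, false.
by rewrite E F K L !addr0 eqxx in wS.
Qed.

(** In an embedded square each traversal of the edge between [j] and [next j] belongs to exactly one
    turn, at [j] or at [next j]. Summing over the four sides regroups the traversals into the two
    windings. *)
Lemma wind_pass j S : along2 (@near G) S ->
  wind j S + wind (next j) S =
  pass j (S false false) (S true false) + pass j (S true false) (S true true) +
  pass j (S true true) (S false true) + pass j (S false true) (S false false).
Proof.
move=> SG; have [S_null|S_null] := boolP (null_square S).
  rewrite !wind_null // addr0;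
    case/or4P: S_null => [/eqP E|/eqP E|/andP[/eqP E /eqP F]|/andP[/eqP E /eqP F]].
  - rewrite -E (passC j (S false false) (S true false)) (passC j (S false false) (S
    false true)).
    by move: (pass _ _ _) (pass _ _ _) => u v; lia.
  - rewrite -E (passC j (S false false) (S true false)) (passC j (S true true) (S true
    false)).
    by move: (pass _ _ _) (pass _ _ _) => u v; lia.
  - by rewrite -E -F !passxx (passC j (S false false) (S false true)) add0r addr0 subrr.
  - by rewrite -E -F !passxx (passC j (S false false) (S true false)) !addr0 subrr.
have := null_or_uniq colourP SG S_null; case: (SG) => S1 S2.
rewrite /= !inE !negb_or => /and4P[/and3P[ab ac ad] /andP[bc bd] cd _].
have nb x y : x != y -> near x y -> adj x y by move=> xy; rewrite /near (negPf xy) orbF.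
have Aab := nb _ _ ab (S2 false); have Aac := nb _ _ ac (S1 false).
have Abd := nb _ _ bd (S1 true); have Acd := nb _ _ cd (S2 true).
(* Given the side from [j] to [next j], each of the other two corners is either a hub or further
   along the cycle. Two hubs, or two far cycle vertices, are not adjacent, so exactly one is a
   hub. *)
have plus p q r s : adj p q -> adj q r -> adj r s -> adj s p -> p != r -> s != q ->
    ((p == cyc j) && (q == cyc (next j)))%:Z =
    [&& s == cyc (prev j), p == cyc j & q == cyc (next j)]%:Z +
    [&& p == cyc j, q == cyc (next j) & r == cyc (next (next j))]%:Z :> int.
  case: (eqVneq p (cyc j)) => [->|_]; last by rewrite andbF.
  case: (eqVneq q (cyc (next j))) => [->|_]; last by rewrite !andbF.
  move=> _; rewrite adj_cyc nextK odd_next => qr rs.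
  rewrite adj_sym adj_cyc => sp rj sq; rewrite (negPf sq) orFb in sp.
  rewrite [r == cyc j]eq_sym (negPf rj) orFb in qr; move: rs.
  have [nj pj npj pnn [ppn ppnn pnnn]] := next_prev_neq j.
  case/orP: sp => /eqP->; case/orP: qr => /eqP->.
  - rewrite adj_cyc nextK /cyc !(inj_eq inl_inj) (negPf pnnn) eq_sym (negPf npj).
    by [].
  - by rewrite !eqxx.
  - by rewrite !eqxx.
  - by [].
(* This is [plus] for the square walked in the reverse direction. *)
have minus p q r s : adj p q -> adj q r -> adj r s -> adj s p -> p != r -> s != q ->
    ((p == cyc (next j)) && (q == cyc j))%:Z =
    [&& s == cyc (next (next j)), p == cyc (next j) & q == cyc j]%:Z +
    [&& p == cyc (next j), q == cyc j & r == cyc (prev j)]%:Z :> int.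
  rewrite ![adj _ q]adj_sym [adj q r]adj_sym ![adj _ s]adj_sym [adj s p]adj_sym.
  move=> qp rq sr ps pr; rewrite eq_sym => qs; have rp : r != p by rewrite eq_sym.
  rewrite andbC (plus q p s r) // addrC; congr (_%:Z + _%:Z).
    by rewrite [in LHS]andbA andbC [(q == _) && _]andbC.
  by rewrite [in LHS]andbC [(q == _) && _]andbC andbA.
pose P (p q r : G) : int := [&& p == cyc (prev j), q == cyc j & r == cyc (next j)]%:Z.
pose M (p q r : G) : int := [&& p == cyc (next j), q == cyc j & r == cyc (prev j)]%:Z.
pose P' (p q r : G) : int := [&& p == cyc j, q == cyc (next j) & r == cyc (next (next
  j))]%:Z.
pose M' (p q r : G) : int :=
  [&& p == cyc (next (next j)), q == cyc (next j) & r == cyc j]%:Z.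
have passE (p q r s : G) : adj p q -> adj q r -> adj r s -> adj s p ->
    p != r -> s != q ->
    pass j p q = (P s p q - M p q r) + (P' p q r - M' s p q).
  move=> pq qr rs sp pr sq; rewrite /pass (plus p q r s) // (minus p q r s) //.
  rewrite -/(P s p q) -/(M p q r) -/(P' p q r) -/(M' s p q).
  by rewrite [M' _ _ _ + _]addrC opprD addrACA.
move: Aab Aac Abd Acd ab ac ad bc bd cd.
set a := S false false; set b := S true false; set c := S false true;
  set d := S true true.
move=> Aab Aac Abd Acd ab ac ad bc bd cd; have [Aca Adc] : adj c a /\ adj d c.
  by rewrite ![adj _ c]adj_sym [adj c a]adj_sym.
have [ca [da cb]] : c != a /\ d != a /\ c != b.
  by rewrite ![c == _]eq_sym [d == _]eq_sym.
rewrite (passE a b d c) // (passE b d c a) // (passE d c a b) // (passE c a b d) //.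
rewrite /wind /turn nextK -/a -/b -/c -/d -!/(P _ _ _) -!/(M _ _ _) -!/(P' _ _ _)
  -!/(M' _ _ _).
clearbody P M P' M' a b c d; clear -P M P' M' a b c d; lia.
Qed.

Definition wind_chain j : C G 2 -> int :=
  lin (fun s : singular_cube G 2 => wind j (fun b c => s (point2 b c))).

HB.instance Definition _ j :=
  GRing.isZmodMorphism.Build (C G 2) int (wind_chain j) (lin_zmod_morphism _).

Definition pass_chain j : C G 1 -> int :=
  lin (fun s : singular_cube G 1 => pass j (s (point1 false)) (s (point1 true))).

HB.instance Definition _ j :=
  GRing.isZmodMorphism.Build (C G 1) int (pass_chain j) (lin_zmod_morphism _).

Lemma wind_chainB j (c d : C G 2) : wind_chain j (c - d) =
  wind_chain j c - wind_chain j d.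
Proof. exact: raddfB. Qed.

Lemma wind_chainD j (c d : C G 2) : wind_chain j (c + d) =
  wind_chain j c + wind_chain j d.
Proof. exact: raddfD. Qed.

Lemma wind_chain0 j : wind_chain j 0 = 0.
Proof. exact: raddf0. Qed.

Lemma pass_chainB j (c d : C G 1) : pass_chain j (c - d) =
  pass_chain j c - pass_chain j d.
Proof. exact: raddfB. Qed.

Lemma pass_chainD j (c d : C G 1) : pass_chain j (c + d) =
  pass_chain j c + pass_chain j d.
Proof. exact: raddfD. Qed.

(** For a degenerate square [lin] gives zero, and so does [wind], since two equal opposite sides
    make the square null. *)
Lemma wind_chain_square j S : along2 (@near G) S -> wind_chain j (square S) = wind j S.
Proof.
move=> SG; have [s sE sC] := cube_classP (along_flat2 (@near_sym G) SG).
have sS : (fun b c => s (point2 b c)) = S.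
  apply: funext => x; apply: funext => y.
  by rewrite -sE /flat2 head_insert0 tail_insert0 head_insert0.
rewrite /square sC [LHS]lin_cls sS; case: ifP => // /existsP[i /eqP E].
apply/esym/wind_null; have Eq q := congr1 (fun t : singular_cube G 1 => t q) E.
have insE b q : insert i b q =
  if i == ord0 then point2 b (head q) else point2 (head q) b.
  have [i0|] := unliftP ord0 i; last by move=> ->; rewrite eqxx {1}[q]point1E.
  move=> ->; rewrite eq_sym (negPf (neq_lift _ _)) [LHS]point2E.
  by rewrite head_insertS tail_insertS (ord1 i0) head_insert0.
have := Eq (point1 true); have := Eq (point1 false);
  rewrite /= !ffunE !insE !head_insert0.
rewrite -sS /null_square; case: ifP => _ -> ->; by rewrite !eqxx ?orbT.
Qed.

Lemma pass_chain_edge j p q : near p q -> pass_chain j (edge p q) = pass j p q.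
Proof.
move=> pq; have [s sE sC] := cube_classP (along_flat1 (@near_sym G) pq).
rewrite /edge sC [LHS]lin_cls -!sE /flat1 !head_insert0.
case: ifP => // /existsP[i /eqP].
rewrite (ord1 i) => /(congr1 (fun t : singular_cube G 0 => t point0)).
by rewrite /= !ffunE -![s _]sE /flat1 !head_insert0 => <-; rewrite passxx.
Qed.

Lemma wind_chain_pass j (x : C G 2) : wind_chain j x + wind_chain (next j) x =
  pass_chain j (bd (C G) 1 x).
Proof.
apply: (chain_ind (P := fun x : C G 2 =>
  wind_chain j x + wind_chain (next j) x = pass_chain j (bd (C G) 1 x))).
- by rewrite !wind_chain0 bd0 (raddf0 (pass_chain j)).
- by move=> y z yE zE; rewrite !wind_chainB bdB pass_chainB -yE -zE opprD addrACA.
move=> s _; have SG := along_point2 (along_cube s).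
rewrite cls2E !wind_chain_square // wind_pass // bd_square // pass_chainD !pass_chainB.
case: (SG) => S1 S2; rewrite !pass_chain_edge //.
move: (s (point2 false false)) (s (point2 true false)) (s (point2 false true))
  (s (point2 true true)) => a b c d.
by rewrite (passC j c d) (passC j a c); lia.
Qed.

Lemma wind_chain_lt j (x : C G 2) : x \in C_lt G 2 2 -> wind_chain j x = 0.
Proof.
apply: (generated_ind (P := fun x : C G 2 => wind_chain j x = 0)) =>
  [|y z yE zE|_ [s /andP[_ s2] ->]].
- exact: wind_chain0.
- by rewrite wind_chainB yE zE subrr.
rewrite cls2E wind_chain_square; last exact/along_point2/along_cube.
exact/wind_null/(degree_null colourP).
Qed.

(** With zero boundary, the windings at [j] and [next j] are opposite, and [next] reaches every
    vertex. *)
Lemma wind_chain_cycle (x : C G 2) : bd (C G) 1 x = 0 ->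
  forall j k, (wind_chain j x == 0) = (wind_chain k x == 0).
Proof.
move=> dx j k; have [m <-] := iter_next_surj j k; elim: m => [|m IHm];
  first exact: erefl.
have := wind_chain_pass (iter m next j) x;
  rewrite dx (raddf0 (pass_chain _)) IHm iterS => /eqP.
by rewrite addr_eq0 => /eqP->; rewrite oppr_eq0.
Qed.

(** The boundary of a cube is a cycle, so a nonzero winding at one vertex spreads to all. By
    [wind_support] the eight corners would then cover the cycle and a hub. *)
Lemma wind_chain_bd j (y : C G 3) : wind_chain j (bd (C G) 2 y) = 0.
Proof.
apply: (chain_ind (P := fun y : C G 3 => wind_chain j (bd (C G) 2 y) = 0)) y =>
  [|y z yE zE|s _].
- by rewrite bd0 wind_chain0.
- by rewrite bdB wind_chainB yE zE subrr.
apply/eqP; apply/negPn/negP => wj.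
have wk k : wind_chain k (bd (C G) 2 (cls s)) != 0.
  by rewrite (wind_chain_cycle (bdK _) k j).
have faces k : (exists p, s p = cyc k) /\ exists d p, s p = hub d.
  case: (pselect (exists (e : 'I_3) b, wind_chain k (cls (face e b s)) != 0)) =>
    [[e [b]]|no]; last first.
    have := wk k; rewrite bd_cls (raddf_sum (wind_chain k)) big1 ?eqxx // => e _.
    have E b : wind_chain k (cls (face e b s)) = 0.
      by apply/eqP; case: eqP => // E; case: no; exists e, b; apply/eqP.
    by rewrite (raddfMz (wind_chain k)) /= wind_chainB !E subrr mul0rz.
  have fG := along_point2 (along_cube (face e b s)).
  rewrite cls2E wind_chain_square // => /(wind_support fG)[[x [y kE]] [x' [y' [d dE]]]].
  split; first by eexists; rewrite /= ffunE in kE; apply: kE.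
  by exists d; eexists; rewrite /= ffunE in dE; apply: dE.
have [_ [d dE]] := faces j.
exact: (card_image (t := s) (b := d) (fun k => (faces k).1) dE).
Qed.

(** * Squares modulo boundaries and chains of degree at most 1 *)

Definition negligible (x : C G 2) : Prop :=
  exists y : C G 3, x - bd (C G) 2 y \in C_lt G 2 2.

Lemma negligible0 : negligible 0.
Proof. by exists 0; rewrite bd0 subrr rpred0. Qed.

Lemma negligible_bd (y : C G 3) : negligible (bd (C G) 2 y).
Proof. by exists y; rewrite subrr rpred0. Qed.

Lemma negligibleB (x y : C G 2) : negligible x -> negligible y -> negligible (x - y).
Proof.
by move=> [u xu] [v yv]; exists (u - v); rewrite bdB subrACA rpredB.
Qed.

Lemma negligibleN (x : C G 2) : negligible x -> negligible (- x).
Proof. by move=> /(negligibleB negligible0); rewrite sub0r. Qed.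

Lemma negligibleD (x y : C G 2) : negligible x -> negligible y -> negligible (x + y).
Proof. by move=> nx /negligibleN/(negligibleB nx); rewrite opprK. Qed.

Lemma null_lt S : along2 (@near G) S -> null_square S -> square S \in C_lt G 2 2.
Proof.
move=> SG S_null.
have FG : along3 (@near G) (fun b c _ => S b c).
  by case: (SG) => S1 S2; split=> [b|//]; split=> [c|//]; rewrite /near eqxx orbT.
have F_null : null_cube (fun b c (_ : bool) => S b c).
  by apply/allP => b _; rewrite S_null /null_square !eqxx ?orbT.
have [l [l_f _ [l1 l2] _]] := image_forest colourP FG F_null.
apply: (carried_forest_lt l_f); apply/carried_cube_class/along_flat2;
  first exact: link_sym.
by split=> b; [apply: (l1 b).2|apply: l2 b false].
Qed.

Lemma negligible_null S : along2 (@near G) S -> null_square S -> negligible (square S).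
Proof. by move=> SG S_null; exists 0; rewrite bd0 subr0 null_lt. Qed.

Definition rotate (S : bool -> bool -> G) b c := S (~~ c) b.
Definition reflect_square (S : bool -> bool -> G) b c := S (~~ b) c.

Lemma along2_rotate S : along2 (@near G) S -> along2 (@near G) (rotate S).
Proof.
move=> [S1 S2]; rewrite /rotate; split=> b /=; last exact: S1.
by rewrite near_sym.
Qed.

Lemma along2_reflect S : along2 (@near G) S -> along2 (@near G) (reflect_square S).
Proof.
move=> [S1 S2]; rewrite /reflect_square; split=> b /=; first exact: S1.
by rewrite near_sym.
Qed.

(** In the cube [F] from [S] to its rotation, every corner moves along one side of the square, so
    the four lateral faces are null. *)
Lemma negligible_rotate S : along2 (@near G) S ->
  negligible (square (rotate S) - square S).
Proof.
move=> SG; pose F t b c := if t then rotate S b c else S b c.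
have S_sym b c b' c' : near (S b c) (S b' c') =
  near (S b' c') (S b c) by exact: near_sym.
have FG : along3 (@near G) F.
  split=> [[]|b c]; [exact: along2_rotate|exact: SG|].
  case: SG => S1 S2; rewrite /F /rotate; case: b c => [] [] //=;
    by rewrite S_sym ?S1 ?S2.
have d := bd_cube FG; have [G1 G2] := FG.
have near_x b : along2 (@near G) (fun t c => F t b c).
  by split=> c; [apply: (G1 c).1|apply: G2].
have near_y b : along2 (@near G) (fun t c => F t c b).
  by split=> c; [apply: (G1 c).2|apply: G2].
have N : negligible ((square (fun t => F t false) - square (fun t => F t true)) +
    (square (fun t c => F t c true) - square (fun t c => F t c false))).
  apply: negligibleD; apply: negligibleB; apply: negligible_null => //;
    by rewrite /null_square /F /rotate /= !eqxx ?orbT.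
by have := negligibleB (negligible_bd (cube F)) N; rewrite d addrK.
Qed.

(** The cube [F] folds the first direction of [S] with time. Its face at [t = false] is [S], its
    face at [b = true] is the reflection, and the other four are null. *)
Lemma negligible_reflect S : along2 (@near G) S ->
  negligible (square (reflect_square S) + square S).
Proof.
move=> SG; pose F t b c := S (b && ~~ t) c.
have S_sym b c b' c' : near (S b c) (S b' c') =
  near (S b' c') (S b c) by exact: near_sym.
have nearxx z : near z z by rewrite /near eqxx orbT.
have FG : along3 (@near G) F.
  case: SG => S1 S2; rewrite /F; split=> [t|b c].
    by split=> b; [exact: S1|case: t => //=; apply: nearxx].
  by case: b => //=; rewrite S_sym.
have d := bd_cube FG; have [G1 G2] := FG.
have near_x b : along2 (@near G) (fun t c => F t b c).
  by split=> c; [apply: (G1 c).1|apply: G2].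
have near_y b : along2 (@near G) (fun t c => F t c b).
  by split=> c; [apply: (G1 c).2|apply: G2].
have rE : square (fun t c => F t true c) = square (reflect_square S) by [].
have sE : square (F false) = square S.
  by congr square; apply: funext => x; apply: funext => y; rewrite /F andbT.
have N : negligible (square (F true) + (square (fun t c => F t false c) +
    (square (fun t c => F t c true) - square (fun t c => F t c false)))).
  apply: negligibleD; last apply: negligibleD; last apply: negligibleB;
    apply: negligible_null => //; rewrite ?[along2 _ _]G1 //;
    by rewrite /null_square /F /= !eqxx ?orbT.
have := negligibleB N (negligible_bd (cube F)); rewrite d rE sE.
rewrite opprD addrACA subKr; move: (_ - square (fun t c => F t c false)) => w.
by rewrite opprD addrACA subrr addr0 subKr addrC.
Qed.

(* The face of the sphere around [j]. *)
Definition star j (b c : bool) : G :=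
  if b then if c then hub (~~ odd j) else cyc (next j)
  else if c then cyc (prev j) else cyc j.

Lemma near_next j : near (cyc j) (cyc (next j)).
Proof. by rewrite /near adj_cyc eqxx. Qed.

Lemma near_hub j : near (cyc j) (hub (odd j)).
Proof. by rewrite /near adj_cyc eqxx !orbT. Qed.

Lemma along2_star j : along2 (@near G) (star j).
Proof.
split=> -[].
- by have := near_hub (next j); rewrite odd_next.
- by have := near_next (prev j); rewrite prevK near_sym.
- by have := near_hub (prev j); rewrite odd_prev.
- exact: near_next.
Qed.

Lemma wind_star j k : wind k (star j) = (j == k)%:Z.
Proof.
rewrite /wind.
have [nj pj npj pnn _] := next_prev_neq j.
have hubF b i : (hub b == cyc i) = false by [].
have cycE i l : (cyc i == cyc l) = (i == l) by exact: (inj_eq inl_inj).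
have [-> -> -> ->] : [/\ star j false false = cyc j, star j true false = cyc (next j),
  star j false true = cyc (prev j) & star j true true = hub (~~ odd j)] by [].
rewrite /turn !hubF !cycE ?(andbF, andFb) !subrr !addr0.
case: (eqVneq j k) => [<-|_]; last by rewrite ?(andbF, andFb).
by rewrite !eqxx [prev j == _]eq_sym (negPf npj).
Qed.

Definition embedded (S : bool -> bool -> G) : Prop :=
  forall b c b' c', S b c = S b' c' -> b = b' /\ c = c'.

Lemma embeddedP S : along2 (@near G) S -> ~~ null_square S -> embedded S.
Proof.
move=> SG /(null_or_uniq colourP SG); rewrite /= !inE !negb_or.
case/and4P=> /and3P[/eqP ab /eqP ac /eqP ad] /andP[/eqP bc /eqP bd] /eqP cd _.
by move=> [] [] [] [] E; split=> //; exfalso; congruence.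
Qed.

Lemma embedded_adj S b c b' c' : near (S b c) (S b' c') -> embedded S ->
  (b, c) != (b', c') -> adj (S b c) (S b' c').
Proof.
case/orP=> // /eqP E S_emb /eqP[]; by have [-> ->] := S_emb _ _ _ _ E.
Qed.

(** If three corners lie on the cycle, the outer two are [prev j] and [next j] for the middle one
    [j], and the fourth corner is their other common neighbour. *)
Lemma embedded_hub S : along2 (@near G) S -> embedded S -> exists b c d, S b c = hub d.
Proof.
move=> [S1 S2] S_emb; case aE : (S false false) => [j|d];
  last by exists false, false, d.
case bE : (S true false) => [k|d]; last by exists true, false, d.
case cE : (S false true) => [l|d]; last by exists false, true, d.
have Sab := embedded_adj (S2 false) S_emb isT;
  have Sac := embedded_adj (S1 false) S_emb isT.
rewrite aE bE adj_cyc orbA [_ || (_ == hub _)]orbC /= in Sab.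
rewrite aE cE adj_cyc orbA [_ || (_ == hub _)]orbC /= in Sac.
have kl : k != l.
  by apply/eqP => E; have [] := S_emb true false false true; rewrite // bE cE E.
have [pj nj] : near (cyc (prev j)) (S true true) /\ near (cyc (next j)) (S true true).
  have bd := S1 true; have cd := S2 true; rewrite bE in bd; rewrite cE in cd.
  case/orP: Sab => /eqP kE; case/orP: Sac => /eqP lE; case: kE => kE; case: lE => lE;
    rewrite ?kE ?lE in bd cd kl; by [rewrite eqxx in kl|split].
case: (common_neighbour pj nj) => [E|E]; last by exists true, true, (~~ odd j).
by have [] := S_emb true true false false; rewrite // E aE.
Qed.

(** The corners next to [hub d] lie on the cycle. The remaining corner cannot be a hub, since it
    would be [hub d] again, so it is some [j] whose two cycle neighbours appear in one of two
    orders. *)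
Lemma embedded_star S d : along2 (@near G) S -> embedded S -> S true true = hub d ->
  exists j, S = star j \/ S = (fun b c => star j c b).
Proof.
move=> [S1 S2] S_emb dE.
have Sbd := embedded_adj (S1 true) S_emb isT;
  have Scd := embedded_adj (S2 true) S_emb isT.
have Sab := embedded_adj (S2 false) S_emb isT;
  have Sac := embedded_adj (S1 false) S_emb isT.
case bE : (S true false) => [k|e]; last by rewrite bE dE in Sbd.
case cE : (S false true) => [l|e]; last by rewrite cE dE in Scd.
have kd : odd k = d by apply/eqP; rewrite bE dE in Sbd.
case aE : (S false false) => [j|e]; last first.
  have [] := S_emb false false true true; rewrite // aE dE -kd.
  by rewrite aE bE in Sab; rewrite (eqP Sab).
rewrite aE bE adj_cyc orbA [_ || (_ == hub _)]orbC /= in Sab.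
rewrite aE cE adj_cyc orbA [_ || (_ == hub _)]orbC /= in Sac.
have kl : k != l.
  by apply/eqP => E; have [] := S_emb true false false true; rewrite // bE cE E.
have jd : d = ~~ odd j.
  by rewrite -kd; case/orP: Sab => /eqP[->]; rewrite ?odd_next ?odd_prev.
exists j; case/orP: Sab => /eqP[kE]; case/orP: Sac => /eqP[lE];
  rewrite kE lE in bE cE kl;
  rewrite ?eqxx // in kl; [left|right]; apply: funext => b; apply: funext => c;
  by case: b c => [] []; rewrite ?aE ?bE ?cE ?dE ?jd.
Qed.

(** Rotations bring a hub to the last corner. A star with exchanged coordinates is, by a reflection
    followed by a rotation, the opposite of the star, whence [e] is [1] or [-1]. *)
Lemma embedded_negligible S : along2 (@near G) S -> embedded S ->
  exists j e, negligible (square S - square (star j) *~ e).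
Proof.
move=> SG S_emb; have [b [c [d dE]]] := embedded_hub SG S_emb.
have rotP T : along2 (@near G) T ->
    (exists j e, negligible (square (rotate T) - square (star j) *~ e)) ->
    exists j e, negligible (square T - square (star j) *~ e).
  move=> TG [j [e N]]; exists j, e.
  have := negligibleB N (negligible_rotate TG).
  by rewrite subrACA subrr sub0r opprB.
have rot_emb T : embedded T -> embedded (rotate T).
  move=> T_emb b' c' b'' c'' /T_emb[/negb_inj-> ->] //.
have base T : along2 (@near G) T -> embedded T -> (exists d, T true true = hub d) ->
    exists j e, negligible (square T - square (star j) *~ e).
  move=> TG T_emb [d' d'E]; have [j [->|->]] := embedded_star TG T_emb d'E.
    by exists j, 1; rewrite mulr1z subrr; apply: negligible0.
  exists j, (-1); rewrite mulrN1z opprK.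
  set T' := fun b c => star j c b.
  have T'G : along2 (@near G) T' by have [S1 S2] := along2_star j; split.
  have N1 := negligible_reflect T'G; have N2 := negligible_rotate (along2_reflect T'G).
  have rE : rotate (reflect_square T') = star j.
    apply: funext => x; apply: funext => y; rewrite /rotate /reflect_square /T'.
    by rewrite negbK.
  have := negligibleD N1 N2; rewrite rE.
  by rewrite [X in X + _]addrC -addrA [_ + (_ - _)]addrC subrK.
have r1 := along2_rotate SG; have r2 := along2_rotate r1; have r3 := along2_rotate r2.
have e1 := rot_emb _ S_emb; have e2 := rot_emb _ e1; have e3 := rot_emb _ e2.
(* Each rotation advances the hub by one corner of the boundary walk, so its initial position fixes
   how many are needed. *)
case: b c dE => [] [] dE.
- by apply: base => //; exists d.
- by do 3!(apply: (rotP) => //); apply: base => //; exists d.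
- by apply: rotP => //; apply: base => //; exists d.
- by do 2!(apply: (rotP) => //); apply: base => //; exists d.
Qed.

Lemma decomposition (x : C G 2) :
  exists a : 'I_(2 * n) -> int, negligible (x - \sum_j square (star j) *~ a j).
Proof.
apply: (chain_ind (P := fun x : C G 2 =>
  exists a : 'I_(2 * n) -> int, negligible (x - \sum_j square (star j) *~ a j))) x.
- exists (fun=> 0); rewrite big1 ?subrr; first exact: negligible0.
  by move=> j _; rewrite mulr0z.
- move=> x y [a Na] [b Nb]; exists (fun j => a j - b j).
  have := negligibleB Na Nb; rewrite subrACA -sumrB.
  by under eq_bigr do rewrite -mulrzBr.
move=> s _; have SG := along_point2 (along_cube s); rewrite cls2E.
have [S_null|S_null] := boolP (null_square (fun b c => s (point2 b c))).
  exists (fun=> 0); rewrite big1 ?subr0; first exact: negligible_null.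
  by move=> j _; rewrite mulr0z.
have [j [e N]] := embedded_negligible SG (embeddedP SG S_null).
exists (fun k => if k == j then e else 0).
rewrite (bigD1 j) //= eqxx big1 ?addr0 // => k /negPf->.
by rewrite mulr0z.
Qed.

(** Windings read off the coefficients of the stars in [decomposition]. When they vanish, [x] is a
    boundary plus a cycle of degree at most 1, which bounds too. *)
Lemma wind_chain_kernel j (x : C G 2) : bd (C G) 1 x = 0 -> wind_chain j x = 0 ->
  exists y : C G 3, x = bd (C G) 2 y.
Proof.
move=> dx wx; have [a [y N]] := decomposition x.
have wxk k : wind_chain k x = 0 by apply/eqP; rewrite (wind_chain_cycle dx k j) wx.
(* Applying [wind_chain k] leaves only [- a k], as it vanishes on [x], on boundaries, on the other
   stars and on chains of degree at most 1. *)
have a0 k : a k = 0.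
  have := wind_chain_lt k N;
    rewrite !wind_chainB wind_chain_bd wxk (raddf_sum (wind_chain k)) (bigD1 k) //=.
  rewrite (raddfMz (wind_chain k)) /= wind_chain_square ?wind_star ?eqxx;
    last exact: along2_star.
  rewrite big1 => [|l lk]; first by rewrite addr0 sub0r subr0 => /eqP;
    rewrite oppr_eq0 intz => /eqP.
  rewrite (raddfMz (wind_chain k)) /= wind_chain_square ?wind_star ?(negPf lk) ?mul0rz
    //.
  exact: along2_star.
rewrite big1 ?subr0 in N; last by move=> k _; rewrite a0 mulr0z.
have dw : bd (C G) 1 (x - bd (C G) 2 y) = 0 by rewrite bdB dx bdK subrr.
have [t _ dt] := degree1_exact2 colourP N dw.
by exists (t + y); rewrite (raddfD (bd (C G) 2)) /= dt subrK.
Qed.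

(** * The fundamental cycle and the second homology *)

Let sign j : int := (-1) ^+ odd j.

(** Signs alternate because windings of a cycle over consecutive faces are opposite. In the
    boundary, [back] replaces the edge from [j] to [next j] by minus its reverse, so that all cycle
    edges point the same way. *)
Definition fundamental_cycle : C G 2 :=
  \sum_j (square (star j) + back (cyc j) (cyc (next j))) *~ sign j.

Lemma wind_chain_fundamental j : wind_chain j fundamental_cycle = sign j.
Proof.
have back0 k : wind_chain j (back (cyc k) (cyc (next k))) = 0.
  rewrite /back wind_chain_square; last first.
    have kk := near_next k; have kk' : near (cyc (next k)) (cyc k) by rewrite near_sym.
    by split=> -[] //=; rewrite /near eqxx orbT.
  by apply: wind_null; rewrite /null_square /= !eqxx.
rewrite (raddf_sum (wind_chain j)) (bigD1 j) //= (raddfMz (wind_chain j)) /=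
  wind_chainD back0 addr0.
rewrite wind_chain_square ?wind_star ?eqxx; last exact: along2_star.
rewrite big1 ?addr0 ?intz // => k kj.
rewrite (raddfMz (wind_chain j)) /= wind_chainD back0 addr0 wind_chain_square
  ?wind_star ?(negPf kj) ?mul0rz //.
exact: along2_star.
Qed.

Lemma bd_fundamental : bd (C G) 1 fundamental_cycle = 0.
Proof.
have signN j : sign (next j) = - sign j.
  by rewrite /sign odd_next; case: (odd j).
pose A j := edge (cyc j) (hub (odd j)) *~ sign j.
pose B j := edge (cyc (next j)) (cyc j) *~ sign j.
have bdM (x : C G 2) e : bd (C G) 1 (x *~ e) = bd (C G) 1 x *~ e by exact: raddfMz.
(* [A] collects the edges to the hubs and [B] the cycle edges. Each term is a difference of shifted
   values, so the sums over the cycle cancel. *)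
have term j : bd (C G) 1 ((square (star j) + back (cyc j) (cyc (next j))) *~ sign j) =
    (A (prev j) - A (next j)) + (B (prev j) - B j).
  rewrite bdM (raddfD (bd (C G) 1)) /= bd_square; last exact: along2_star.
  rewrite bd_back; last exact: near_next.
  rewrite /star /A /B odd_next odd_prev prevK signN.
  have -> : sign (prev j) = - sign j by rewrite -[in RHS](prevK j) signN opprK.
  rewrite !mulrNz opprK.
  set u := edge _ _; set v := edge (cyc j) _; set w := edge _ (hub _);
    set z := edge _ (cyc j).
  move: (edge (cyc j) (cyc (next j))) => e.
  rewrite [e - w]addrC opprD !addrA addrK [u - v - w]addrAC [u - w]addrC.
  by rewrite !mulrzDl !mulNrz.
rewrite (raddf_sum (bd (C G) 1)) (eq_bigr _ (fun j _ => term j)) big_split /= !sumrB.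
have sum_prev (F : 'I_(2 * n) -> C G 1) : \sum_j F (prev j) = \sum_j F j.
  by rewrite [RHS](reindex_inj (can_inj prevK)).
have sum_next (F : 'I_(2 * n) -> C G 1) : \sum_j F (next j) = \sum_j F j.
  by rewrite [RHS](reindex_inj (can_inj nextK)).
by rewrite !sum_prev sum_next !subrr addr0.
Qed.

(** The isomorphism is the winding at the vertex 0. As 0 is even, the fundamental cycle has winding
    1 there, and its multiples reach every integer. *)
Lemma second_homology : isomorphic (H 2 G) int.
Proof.
have n2 : (0 < 2 * n)%N by lia.
pose j0 : 'I_(2 * n) := Ordinal n2.
pose f (c : subgroup (@cycles (C G) 2)) : int := wind_chain j0 (val c).
have f_morph : zmod_morphism f by move=> c d; rewrite /f wind_chainB.
pose fM := GRing.isZmodMorphism.Build _ _ f f_morph.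
pose fA : {additive subgroup (@cycles (C G) 2) -> int} := HB.pack f fM.
apply: (@isomorphic_subquotient _ _ _ _ fA) => [c|e].
  split=> [fc|/asboolP[y yE]]; last by rewrite /= /f yE wind_chain_bd.
  have dc : bd (C G) 1 (val c) = 0 by apply/eqP; exact: (valP c).
  by apply/asboolP; apply: wind_chain_kernel dc fc.
have zC : fundamental_cycle *~ e \in @cycles (C G) 2.
  apply: rpredMz; rewrite unfold_in; apply/eqP; exact: bd_fundamental.
exists (Sub (fundamental_cycle *~ e) zC);
  rewrite /= /f SubK (raddfMz (wind_chain j0)) /=.
by rewrite wind_chain_fundamental /sign /= expr0 intz.
Qed.
End Greene.

Local Close Scope ring_scope.

Theorem theorem6p2 (n : nat) (hn : (4 <= n)%N) :
  isomorphic (H 2 (greene_sphere n)) int /\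
  isomorphic (H 3 (greene_sphere n)) (H_deg 2 3 (greene_sphere n)).
Proof.
split; first exact: second_homology.
exact: (third_homology (@colourP n) (greene_degree_lt3 hn)).
Qed.
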